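(* Let $\overline{\zeta}\in\mathfrak{X}(\pi(M))$ be a concurrent $\pi$-vector field on a Finsler manifold $(M,L)$, and let $S$, $P$, $R$ be the $v$-, $hv$- and $h$-curvature tensors of the Cartan connection $\nabla$. Then for all $\overline{X},\overline{Y},\overline{Z}\in\mathfrak{X}(\pi(M))$ the following hold. For the $v$-curvature tensor $S$: (a) $S(\overline{X},\overline{Y})\overline{\zeta}=0$, and $S(\overline{X},\overline{Y},\overline{Z},\overline{\zeta})=0$; (b) $(\nabla_{\gamma\overline{Z}}S)(\overline{X},\overline{Y},\overline{\zeta})=0$, and $(\nabla_{\beta\overline{Z}}S)(\overline{X},\overline{Y},\overline{\zeta})=S(\overline{X},\overline{Y})\overline{Z}$; (c) $(\nabla_{\beta\overline{\zeta}}S)(\overline{X},\overline{Y},\overline{\zeta})=0$. For the $hv$-curvature tensor $P$: (d) $P(\overline{X},\overline{Y})\overline{\zeta}=-T(\overline{Y},\overline{X})$, and $P(\overline{X},\overline{Y},\overline{Z},\overline{\zeta})=T(\overline{X},\overline{Y},\overline{Z})$; (e) $(\nabla_{\gamma\overline{Z}}P)(\overline{X},\overline{Y},\overline{\zeta})=-(\nabla_{\gamma\overline{Z}}T)(\overline{Y},\overline{X})$, and $(\nabla_{\beta\overline{Z}}P)(\overline{X},\overline{Y},\overline{\zeta})=-(\nabla_{\beta\overline{Z}}T)(\overline{Y},\overline{X})+P(\overline{X},\overline{Y})\overline{Z}$; (f) $(\nabla_{\beta\overline{\zeta}}P)(\overline{X},\overline{Y},\overline{\zeta})=-(\nabla_{\beta\overline{\zeta}}T)(\overline{Y},\overline{X})-T(\overline{Y},\overline{X})$.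 For the $h$-curvature tensor $R$: (g) $R(\overline{X},\overline{Y})\overline{\zeta}=0$, and $R(\overline{X},\overline{Y},\overline{Z},\overline{\zeta})=0$; (h) $(\nabla_{\gamma\overline{Z}}R)(\overline{X},\overline{Y},\overline{\zeta})=0$, and $(\nabla_{\beta\overline{Z}}R)(\overline{X},\overline{Y},\overline{\zeta})=R(\overline{X},\overline{Y})\overline{Z}$; (i) $(\nabla_{\beta\overline{\zeta}}R)(\overline{X},\overline{Y},\overline{\zeta})=0$.
   Context: $M$ is a real paracompact smooth manifold of finite dimension $n$; all objects are $C^\infty$. $\pi:\mathcal{T}M\to M$ is the bundle of nonzero tangent vectors, $\pi^{-1}(TM)\to\mathcal{T}M$ the pullback of $TM$ by $\pi$. Sections of $\pi^{-1}(TM)$ are called $\pi$-vector fields, are written with bars, and form the module $\mathfrak{X}(\pi(M))$. The fundamental $\pi$-vector field is $\overline{\eta}(u)=(u,u)$. $\rho:T(\mathcal{T}M)\to\pi^{-1}(TM)$ is $\rho=(\pi_{\mathcal{T}M},d\pi)$, and $\gamma:\pi^{-1}(TM)\to T(\mathcal{T}M)$ is the vertical lift $\gamma(u,v)=j_u(v)$, with $j_u:T_{\pi(u)}M\to T_u(T_{\pi(u)}M)$ the natural isomorphism. $(M,L)$ is a Finsler manifold with Finsler metric $g$ on $\pi^{-1}(TM)$ (locally $g_{ij}=\frac12\partial^2L^2/\partial y^i\partial y^j$). For a linear connection $D$ on $\pi^{-1}(TM)$ its connection map is $K(X)=D_X\overline{\eta}$; $D$ is regular if $T_u(\mathcal{T}M)=V_u(\mathcal{T}M)\oplus\ker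 K_u$ for all $u$ ($V$ the vertical bundle), and then its horizontal map is $\beta:=(\rho|_{\ker K})^{-1}$. The torsion is $\mathbf{T}(X,Y)=D_X\rho Y-D_Y\rho X-\rho[X,Y]$, with $Q(\overline{X},\overline{Y})=\mathbf{T}(\beta\overline{X},\beta\overline{Y})$ and $(h)hv$-torsion $T(\overline{X},\overline{Y})=\mathbf{T}(\gamma\overline{X},\beta\overline{Y})$. The curvature is $\mathbf{K}(X,Y)\rho Z=-D_XD_Y\rho Z+D_YD_X\rho Z+D_{[X,Y]}\rho Z$, with $R(\overline{X},\overline{Y})\overline{Z}=\mathbf{K}(\beta\overline{X},\beta\overline{Y})\overline{Z}$, $P(\overline{X},\overline{Y})\overline{Z}=\mathbf{K}(\beta\overline{X},\gamma\overline{Y})\overline{Z}$, $S(\overline{X},\overline{Y})\overline{Z}=\mathbf{K}(\gamma\overline{X},\gamma\overline{Y})\overline{Z}$. The Cartan connection $\nabla$ is the unique regular connection on $\pi^{-1}(TM)$ with $\nabla g=0$, $Q=0$ and $g(T(\overline{X},\overline{Y}),\overline{Z})=g(T(\overline{X},\overline{Z}),\overline{Y})$. Here $\beta,T,R,P,S$ are those of $\nabla$. A $\pi$-vector field $\overline{\zeta}$ is concurrent if $\nabla_{\beta\overline{X}}\overline{\zeta}=-\overline{X}$ and $\nabla_{\gamma\overline{X}}\overline{\zeta}=0$ for all $\overline{X}$. Notation: $T(\overline{X},\overline{Y},\overline{Z}):=g(T(\overline{X},\overline{Y}),\overline{Z})$ and, for $A\in\{R,P,S\}$, $A(\overline{X},\overline{Y},\overline{Z},\overline{W}):=g(A(\overline{X},\overline{Y})\overline{Z},\overline{W})$;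 $(\nabla_WA)(\overline{X},\overline{Y},\overline{Z})$ is the covariant derivative of the $\pi$-tensor field $(\overline{X},\overline{Y},\overline{Z})\mapsto A(\overline{X},\overline{Y})\overline{Z}$. *)

(* Defs.v *)
From mathcomp Require Import all_boot all_order all_algebra.
From mathcomp Require Import all_classical all_reals all_analysis.
Import Order.TTheory GRing.Theory Num.Theory.
Import numFieldNormedType.Exports.

Set Implicit Arguments.
Unset Strict Implicit.
Unset Printing Implicit Defensive.

Local Open Scope classical_set_scope.
Local Open Scope ring_scope.

Section Smooth.
Context {R : realType} {m : nat} {V : normedModType R}.

Definition iter_partial (s : seq 'I_m) (f : 'rV[R]_m -> V) : 'rV[R]_m -> V :=
  foldr (fun i h => 'D_(delta_mx 0 i) h) f s.

(* C^oo on the open set U: the iterated partial derivatives of every order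
   exist and are continuous on U. *)
Definition smooth_on (U : set 'rV[R]_m) (f : 'rV[R]_m -> V) : Prop :=
  forall (s : seq 'I_m) (x : 'rV[R]_m), U x ->
    {for x, continuous (iter_partial s f)} /\
    forall i : 'I_m, derivable (iter_partial s f) x (delta_mx 0 i).

End Smooth.

(* Bare data of an atlas on a set N, with a chosen chart around each point.
   The axioms are in [manifold] below; the slit tangent bundle of a manifold
   only needs the data. *)
Record atlas (R : realType) (m : nat) (N : Type) := Atlas {
  chart : Type;
  chart_dom : chart -> set N;
  chart_coord : chart -> N -> 'rV[R]_m;
  chart_at : N -> chart }.

(* A tangent vector at p is represented by its components in the chart
   [chart_at A p]; the components in any other chart a around p are then given
   by [component a] below, the differential of the change of charts. *)
Definition tangent {R : realType} {m : nat} {N : Type} (A : atlas R m N)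
    (p : N) : normedModType R := 'rV[R]_m.

Section Charted.
Context {R : realType} {m : nat} {N : Type} (A : atlas R m N).

(* f \o (chart_coord a)^-1 on the image of the chart a, extended by 0. *)
Definition local_rep (a : chart A) {V : normedModType R} (f : N -> V) :
    'rV[R]_m -> V :=
  fun x => if pselect (exists p, chart_dom a p /\ chart_coord a p = x) is left e
           then f (projT1 (cid e)) else 0.

Definition chart_image (a : chart A) : set 'rV[R]_m :=
  chart_coord a @` chart_dom a.

Definition component (a : chart A) (p : N) (v : tangent A p) : 'rV[R]_m :=
  'D_v (local_rep (chart_at A p) (chart_coord a))
    (chart_coord (chart_at A p) p).

Definition smooth_map {V : normedModType R} (f : N -> V) : Prop :=
  forall a, smooth_on (chart_image a) (local_rep a f).

Definition dirder {V : normedModType R} (f : N -> V) (p : N) (v : tangent A p)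
    : V :=
  'D_v (local_rep (chart_at A p) f) (chart_coord (chart_at A p) p).

Definition vector_field := forall p : N, tangent A p.

Definition vf_rep (a : chart A) (X : vector_field) : 'rV[R]_m -> 'rV[R]_m :=
  local_rep a (fun p => component a (X p)).

Definition smooth_vf_on (a : chart A) (X : vector_field) : Prop :=
  smooth_on (chart_image a) (vf_rep a X).

Definition smooth_vf (X : vector_field) : Prop := forall a, smooth_vf_on a X.

Definition lie_bracket (X Y : vector_field) : vector_field := fun p =>
  let a := chart_at A p in
  'D_(X p) (vf_rep a Y) (chart_coord a p)
  - 'D_(Y p) (vf_rep a X) (chart_coord a p).

End Charted.

Arguments component {R m N A} a {p} v.
Arguments dirder {R m N A V} f {p} v.

Definition tangent_map {R : realType} {m k : nat} {N N' : Type}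
    {A : atlas R m N} {A' : atlas R k N'} (f : N -> N') (p : N)
    (v : tangent A p) : tangent A' (f p) :=
  dirder (fun q => chart_coord (chart_at A' (f p)) (f q)) v.
Arguments tangent_map {R m k N N' A A'} f {p} v.

Definition open_cover (T : topologicalType) (U : set (set T)) : Prop :=
  (forall B, U B -> open B) /\ \bigcup_(B in U) B = setT.

Definition paracompact_space (T : topologicalType) : Prop :=
  forall U : set (set T), open_cover U ->
  exists V : set (set T), [/\ open_cover V,
    forall B, V B -> exists2 C, U C & B `<=` C &
    forall p : T, exists2 W, nbhs p W &
      finite_set (V `&` [set B | B `&` W !=set0])].

Record manifold (R : realType) (n : nat) := Manifold {
  space :> topologicalType;
  charts :> atlas R n space;
  manifold_hausdorff : hausdorff_space space;
  manifold_paracompact : paracompact_space space;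
  chart_at_dom : forall p : space, chart_dom (chart_at charts p) p;
  dom_open : forall a : chart charts, open (chart_dom a);
  coord_inj : forall a : chart charts,
    {in chart_dom a &, injective (chart_coord a)};
  coord_continuous : forall (a : chart charts) (p : space), chart_dom a p ->
    {for p, continuous (chart_coord a)};
  coord_open : forall (a : chart charts) (U : set space),
    open U -> U `<=` chart_dom a -> open (chart_coord a @` U);
  transition_smooth : forall a b : chart charts,
    smooth_on (chart_coord a @` (chart_dom a `&` chart_dom b))
      (local_rep a (chart_coord b)) }.

Section Pullback.
Context {R : realType} {n : nat} (M : manifold R n).

Record slit := Slit {
  base_pt : M;
  vec : tangent M base_pt;
  vec_neq0 : vec != 0 }.

(* Coordinates (x^i, y^i) on TM induced by a chart of M. *)
Definition bundle_coord (a : chart M) (p : M) (v : tangent M p) :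
    'rV[R]_(n + n) := row_mx (chart_coord a p) (component a v).

Definition slit_atlas : atlas R (n + n) slit := {|
  chart := chart M;
  chart_dom := fun a => [set u | chart_dom a (base_pt u)];
  chart_coord := fun a u => bundle_coord a (vec u);
  chart_at := fun u => chart_at M (base_pt u) |}.

(* All sections of pi^-1(TM), smooth or not: the fibre at u is
   T_(pi u) M. *)
Definition pi_section := forall u : slit, tangent M (base_pt u).

Definition smooth_pi_on (a : chart M) (Y : pi_section) : Prop :=
  smooth_on (chart_image (A := slit_atlas) a)
    (local_rep (A := slit_atlas) a (fun u => component a (Y u))).

Definition smooth_pi (Y : pi_section) : Prop := forall a, smooth_pi_on a Y.

Definition eta : pi_section := vec.

Definition rho (u : slit) (xi : tangent slit_atlas u) : tangent M (base_pt u) :=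
  tangent_map base_pt xi.

(* The vertical lift: the velocity at t = 0 of the curve t |-> u + t v, read in
   the chart of [slit_atlas] chosen at u. *)
Definition gamma (u : slit) (v : tangent M (base_pt u)) :
    tangent slit_atlas u :=
  derive1
    (fun t : R => bundle_coord (chart_at M (base_pt u)) (vec u + t *: v)) 0.

Definition vertical (u : slit) (xi : tangent slit_atlas u) : Prop :=
  rho xi = 0.

Definition rho_vf (X : vector_field slit_atlas) : pi_section :=
  fun u => rho (X u).

Definition gamma_vf (Y : pi_section) : vector_field slit_atlas :=
  fun u => gamma (Y u).

(* g_u (v, w) = g_ij v^i w^j with g_ij = 1/2 d^2 L^2 / dy^i dy^j, in the
   coordinates y^i of the chart [chart_at M (base_pt u)]. *)
Definition metric_coef (L : forall p : M, tangent M p -> R) (u : slit)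
    (i j : 'I_n) : R :=
  2^-1 * iter_partial [:: i; j]
           (fun y : 'rV[R]_n => (L (base_pt u) y ^+ 2 : R^o)) (vec u).

Definition metric (L : forall p : M, tangent M p -> R) (u : slit)
    (v w : tangent M (base_pt u)) : R :=
  \sum_(i < n) \sum_(j < n)
    metric_coef L u i j * (v : 'rV[R]_n) 0 i * (w : 'rV[R]_n) 0 j.

Record finsler (L : forall p : M, tangent M p -> R) : Prop := {
  finsler_smooth : smooth_map slit_atlas (fun u => L _ (vec u) : R^o);
  finsler_zero : forall p : M, L p 0 = 0;
  finsler_pos : forall (p : M) (v : tangent M p), v != 0 -> 0 < L p v;
  finsler_homogeneous : forall (p : M) (v : tangent M p) (c : R),
    0 < c -> L p (c *: v) = c * L p v;
  finsler_posdef : forall (u : slit) (v : tangent M (base_pt u)),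
    v != 0 -> 0 < metric L v v }.

(* D u xi Y is the covariant derivative at u of the section Y in the direction
   xi in T_u(TM \ 0). Only its values at smooth Y are constrained below. *)
Definition pi_derivation :=
  forall u : slit, tangent slit_atlas u -> pi_section -> tangent M (base_pt u).

Definition covd (D : pi_derivation) (X : vector_field slit_atlas)
    (Y : pi_section) : pi_section := fun u => D u (X u) Y.

Record linear_connection (D : pi_derivation) : Prop := {
  connection_linear : forall (u : slit) (Y : pi_section), smooth_pi Y ->
    forall (c : R) (xi xi' : tangent slit_atlas u),
      D u (c *: xi + xi') Y = c *: D u xi Y + D u xi' Y;
  connection_additive : forall (u : slit) (xi : tangent slit_atlas u)
      (Y Z : pi_section), smooth_pi Y -> smooth_pi Z ->
    D u xi (fun w => Y w + Z w) = D u xi Y + D u xi Z;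
  connection_leibniz : forall (u : slit) (xi : tangent slit_atlas u)
      (f : slit -> R^o) (Y : pi_section),
    smooth_map slit_atlas f -> smooth_pi Y ->
    D u xi (fun w => f w *: Y w) =
      (dirder f xi : R) *: Y u + f u *: D u xi Y;
  (* D Y is a smooth section of Hom(T(TM \ 0), pi^-1(TM)): over each chart
     domain it maps smooth vector fields to smooth sections. *)
  connection_smooth : forall (a : chart M) (X : vector_field slit_atlas)
      (Y : pi_section), smooth_vf_on (A := slit_atlas) a X -> smooth_pi Y ->
    smooth_pi_on a (covd D X Y) }.

Section Connection.
Variable D : pi_derivation.

Definition connection_map (u : slit) (xi : tangent slit_atlas u) :
    tangent M (base_pt u) := D xi eta.

(* T_u(TM \ 0) = V_u (+) ker K_u *)
Definition regular : Prop := forall u : slit,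
  (forall xi : tangent slit_atlas u, exists xi1 xi2 : tangent slit_atlas u,
     [/\ vertical xi1, connection_map xi2 = 0 & xi = xi1 + xi2]) /\
  (forall xi : tangent slit_atlas u,
     vertical xi -> connection_map xi = 0 -> xi = 0).

(* The horizontal map (rho|ker K)^-1, extended by 0 if v has no preimage. *)
Definition beta (u : slit) (v : tangent M (base_pt u)) : tangent slit_atlas u :=
  xget 0 [set xi : tangent slit_atlas u | connection_map xi = 0 /\ rho xi = v].

Definition beta_vf (Y : pi_section) : vector_field slit_atlas :=
  fun u => beta (Y u).

Definition torsion (X Y : vector_field slit_atlas) : pi_section := fun u =>
  covd D X (rho_vf Y) u - covd D Y (rho_vf X) u
  - rho_vf (lie_bracket X Y) u.

Definition Q_torsion (X Y : pi_section) : pi_section :=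
  torsion (beta_vf X) (beta_vf Y).

Definition T_torsion (X Y : pi_section) : pi_section :=
  torsion (gamma_vf X) (beta_vf Y).

Definition curvature (X Y : vector_field slit_atlas) (Z : pi_section) :
    pi_section := fun u =>
  - covd D X (covd D Y Z) u + covd D Y (covd D X Z) u
  + covd D (lie_bracket X Y) Z u.

Definition R_curv (X Y Z : pi_section) : pi_section :=
  curvature (beta_vf X) (beta_vf Y) Z.

Definition P_curv (X Y Z : pi_section) : pi_section :=
  curvature (beta_vf X) (gamma_vf Y) Z.

Definition S_curv (X Y Z : pi_section) : pi_section :=
  curvature (gamma_vf X) (gamma_vf Y) Z.

Definition covd_tensor2 (W : vector_field slit_atlas)
    (A : pi_section -> pi_section -> pi_section) (X Y : pi_section) :
    pi_section := fun u =>
  covd D W (A X Y) u - A (covd D W X) Y u - A X (covd D W Y) u.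

Definition covd_tensor3 (W : vector_field slit_atlas)
    (A : pi_section -> pi_section -> pi_section -> pi_section)
    (X Y Z : pi_section) : pi_section := fun u =>
  covd D W (A X Y Z) u - A (covd D W X) Y Z u - A X (covd D W Y) Z u
  - A X Y (covd D W Z) u.

Record cartan_connection (L : forall p : M, tangent M p -> R) : Prop := {
  cartan_connection_linear : linear_connection D;
  cartan_connection_regular : regular;
  cartan_connection_metric : forall (u : slit) (xi : tangent slit_atlas u)
      (Y Z : pi_section), smooth_pi Y -> smooth_pi Z ->
    dirder (fun w => metric L (Y w) (Z w) : R^o) xi =
      metric L (D xi Y) (Z u) + metric L (Y u) (D xi Z);
  cartan_connection_Q : forall X Y : pi_section, smooth_pi X -> smooth_pi Y ->
    forall u, Q_torsion X Y u = 0;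
  cartan_connection_T : forall X Y Z : pi_section,
    smooth_pi X -> smooth_pi Y -> smooth_pi Z ->
    forall u, metric L (T_torsion X Y u) (Z u) =
              metric L (T_torsion X Z u) (Y u) }.

Record concurrent (zeta : pi_section) : Prop := {
  concurrent_smooth : smooth_pi zeta;
  concurrent_beta : forall X : pi_section, smooth_pi X ->
    forall u, covd D (beta_vf X) zeta u = - X u;
  concurrent_gamma : forall X : pi_section, smooth_pi X ->
    forall u, covd D (gamma_vf X) zeta u = 0 }.

End Connection.
End Pullback.

(* Main.v *)
Require Import Defs.
From HB Require Import structures.
From mathcomp Require Import all_boot all_order all_algebra.
From mathcomp Require Import all_classical all_reals all_analysis.
From mathcomp Require Import ring lra.
Import Order.TTheory GRing.Theory Num.Theory.
Import numFieldNormedType.Exports.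

(** Let nabla be the connection, rho the projection to the base part, beta and gamma the
    horizontal and vertical lifts. A concurrent section satisfies nabla_V zeta = - rho V
    for every smooth field V on the slit tangent bundle. Hence the curvature applied to
    zeta is a torsion: the three terms of K(V, W) zeta become those of T(V, W). For two
    vertical lifts this torsion is 0, because the bracket of vertical fields is vertical
    and rho kills vertical fields; for a horizontal and a vertical lift it is - T(Y, X)
    since torsion is antisymmetric; for two horizontal lifts it is Q = 0
    ([curvature_concurrent]). The identities for covariant derivatives follow by
    differentiating these three, the correction term being the curvature applied to
    nabla_V zeta = - rho V ([covd_tensor3_concurrent]).

    The identities with zeta in the last place come from the skewness of the curvature
    for a metric connection ([curvature_metric_skew]). For the hv-curvature this gives
    g(T(Y, X), Z), and it remains to know that T is symmetric: up to a constant
    g(T(X, Y), Z) is the third derivative of L^2 along the fibre in the directions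
    X, Y, Z ([T_torsion_third]), and iterated derivatives commute.

    Two points need care. First, the conditions on zeta and on nabla speak of global
    smooth sections, so nabla zeta can be evaluated on a bracket only if the bracket is
    the sum of the lifts of two smooth sections. This holds because brackets of smooth
    fields are smooth ([smooth_lie_bracket]) and because the horizontal map is smooth: in
    a chart it solves a linear system whose coefficients are smooth and whose determinant
    does not vanish ([smooth_beta]). Second, brackets, derivatives and the metric are
    defined at each point with a chart chosen at that point, so that their smoothness and
    the commutation rule for brackets have to be obtained from formulas in a fixed chart.
    The tool is the chain rule for changes of charts, applied both to the manifold and
    to the atlas (x, y) |-> (phi x, D phi (x) y) of its slit tangent bundle
    ([slit_smooth_atlas]).

    Smoothness is defined by the continuity of all iterated partial derivatives. Such
    functions are differentiable ([differentiable_of_partials]), closed under the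
    operations used ([smooth_expr_smooth]) and have symmetric second derivatives
    ([schwarz]). *)

Set Implicit Arguments.
Unset Strict Implicit.
Unset Printing Implicit Defensive.

Local Open Scope classical_set_scope.
Local Open Scope ring_scope.

(** * Derivatives along a direction *)

Section Derivative.
Context {R : realType}.
Implicit Types V W E : normedModType R.

(** Both sides are limits of the same difference quotients. This computes derivatives
    along a fibre or a line without the chain rule. *)
Lemma derive_affine_comp V W E (f : W -> E) (l : V -> W) x v w :
  (forall h : R, l (h *: v + x) = h *: w + l x) ->
  'D_v (f \o l) x = 'D_w f (l x).
Proof.
move=> hl; rewrite /derive; set a := (X in lim (X @ _)); set b := (X in _ = lim (X @ _)).
by suff -> : a = b by []; apply/funext => h; rewrite /a /b /= hl.
Qed.

Lemma derive_along_line V W (f : V -> W) x v w :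
  (forall h : R, f (h *: v + x) = h *: w + f x) -> 'D_v f x = w.
Proof.
by move=> hf; apply: (etrans (@derive_affine_comp _ _ _ id f x v w hf)); rewrite derive_id.
Qed.

Lemma derive_chain V W E (f : V -> W) (g : W -> E) x v :
  differentiable f x -> differentiable g (f x) ->
  'D_v (g \o f) x = 'D_('D_v f x) g (f x).
Proof.
move=> df dg; rewrite (deriveE _ df) (deriveE _ dg).
have dgf : differentiable (g \o f) x by exact: differentiable_comp.
by rewrite (deriveE _ dgf) (diff_comp df dg).
Qed.

Lemma derive_linear V W (f : V -> W) x (c : R) u v : differentiable f x ->
  'D_(c *: u + v) f x = c *: 'D_u f x + 'D_v f x.
Proof. by move=> df; rewrite !(deriveE _ df) linearP. Qed.

Lemma derive_basis m W (f : 'rV[R]_m -> W) x v : differentiable f x ->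
  'D_v f x = \sum_i v 0 i *: 'D_(delta_mx 0 i) f x.
Proof.
move=> df; rewrite (deriveE _ df) {1}[v]row_sum_delta linear_sum.
by apply: eq_bigr => i _; rewrite linearZ (deriveE _ df).
Qed.

Lemma differentiable_rowP V m (f : V -> 'rV[R]_m) x :
  (forall j, differentiable (fun y => f y 0 j : R) x) -> differentiable f x.
Proof.
move=> df; have -> : f = \sum_j (fun y => f y 0 j *: delta_mx 0 j).
  apply/funext => y; rewrite fct_sumE; exact: row_sum_delta.
by apply: differentiable_sum => j; apply: differentiableZl.
Qed.

Lemma derive_row_coord V m (f : V -> 'rV[R]_m) x v j :
  derivable f x v -> ('D_v f x) 0 j = 'D_v (fun y => f y 0 j : R) x.
Proof. by move=> df; rewrite derive_mx// mxE. Qed.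

Lemma linear_row_differentiable m W (L : {linear 'rV[R]_m -> W}) x :
  differentiable L x.
Proof.
have -> : (L : 'rV[R]_m -> W) = \sum_j (fun y : 'rV[R]_m => y 0 j *: L (delta_mx 0 j)).
  apply/funext => y; rewrite fct_sumE {1}[y]row_sum_delta linear_sum.
  by apply: eq_bigr => j _; rewrite linearZ.
by apply: differentiable_sum => j; apply: differentiableZl; exact: differentiable_coord.
Qed.

Lemma derive_linear_comp V m W (L : {linear 'rV[R]_m -> W}) (f : V -> 'rV[R]_m) x v :
  differentiable f x -> 'D_v (fun y => L (f y)) x = L ('D_v f x).
Proof.
move=> df; apply: (etrans (derive_chain v df (linear_row_differentiable L (f x)))).
by apply: derive_along_line => h; rewrite linearP.
Qed.

(** The mean value theorem for t |-> f (t *: v + x). The sign of s is arbitrary, so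
    that coordinate increments of both signs are covered. *)
Lemma mean_value_line V (f : V -> R) x v (s : R) :
  (forall t : R, `|t| <= `|s| -> derivable f (t *: v + x) v) ->
  exists2 c, `|c| <= `|s| & f (s *: v + x) - f x = s * 'D_v f (c *: v + x).
Proof.
move=> df; pose g (t : R) := f (t *: v + x).
have dg (t : R) : `|t| <= `|s| -> is_derive t 1 g ('D_v f (t *: v + x)).
  move=> ts; have e h : (fun t : R => t *: v + x) (h *: (1 : R^o) + t) =
      h *: v + (t *: v + x) by rewrite /= [h *: 1]mulr1 scalerDl addrA.
  apply: DeriveDef; last exact: (derive_affine_comp f e).
  have := df t ts; rewrite /derivable; set a := (X in X @ _);
    set b := (X in _ -> cvg (X @ _)).
  by suff -> : a = b by []; apply/funext => h;
    rewrite /a /b /g /= [h%:A]mulr1 scalerDl addrA.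
have cg (a b : R) : (forall t, t \in `[a, b]%R -> `|t| <= `|s|) ->
    {within `[a, b], continuous g}.
  by move=> ab; apply: derivable_within_continuous => t /ab /dg [].
have [s0|s0] := leP 0 s.
  have abs t : t \in `[0, s]%R -> `|t| <= `|s|.
    by rewrite in_itv/= => /andP[t0 ts]; rewrite !ger0_norm.
  have [||c cs] := @MVT_segment R g (fun t => 'D_v f (t *: v + x)) 0 s s0.
  - by move=> t ht; apply: dg; apply: abs; apply: subset_itv_oo_cc ht.
  - exact: cg.
  rewrite /g scale0r add0r subr0 mulrC => ->; exists c => //; exact: abs.
have abs t : t \in `[s, 0]%R -> `|t| <= `|s|.
  by rewrite in_itv/= => /andP[ts t0]; rewrite !ler0_norm ?lerN2// ltW.
have [||c cs] := @MVT_segment R g (fun t => 'D_v f (t *: v + x)) s 0 (ltW s0).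
- by move=> t ht; apply: dg; apply: abs; apply: subset_itv_oo_cc ht.
- exact: cg.
rewrite /g scale0r add0r sub0r => /eqP e; exists c; first exact: abs.
by apply/eqP; rewrite -opprB -eqr_opp opprK (eqP e); apply/eqP; ring.
Qed.

End Derivative.

(** * Continuous partial derivatives imply differentiability *)

Section SmoothDifferentiable.
Context {R : realType} {m : nat}.
Implicit Types (U : set 'rV[R]_m) (f g : 'rV[R]_m -> R).

(** The vertices x, x + trunc_row 1 h, x + trunc_row 2 h, ... of the polygonal line
    that joins x to x + h by moving one coordinate at a time. *)
Definition trunc_row (k : nat) (h : 'rV[R]_m) : 'rV[R]_m :=
  \row_i (if (i < k)%N then h 0 i else 0).

Lemma le_coord_norm (h : 'rV[R]_m) i : `|h 0 i| <= `|h|.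
Proof.
rewrite [leRHS]/Num.Def.normr/= mx_normrE.
exact: (le_bigmax _ (fun ij : 'I_1 * 'I_m => `|h ij.1 ij.2|) (0, i)).
Qed.

Lemma row_norm_le (h : 'rV[R]_m) (r : R) :
  0 <= r -> (forall i, `|h 0 i| <= r) -> `|h| <= r.
Proof.
move=> r0 hr; rewrite /Num.Def.normr/= mx_normrE; apply: bigmax_le => // -[i j] _ /=.
by rewrite ord1.
Qed.

Lemma trunc_rowS k (h : 'rV[R]_m) (km : (k < m)%N) :
  trunc_row k.+1 h = h 0 (Ordinal km) *: delta_mx 0 (Ordinal km) + trunc_row k h.
Proof.
apply/rowP => j; rewrite !mxE eqxx andTb ltnS leq_eqVlt.
have [jk|jk] := eqVneq (j : nat) k.
  have -> : j = Ordinal km by exact: val_inj.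
  by rewrite eqxx mulr1 /= ltnn addr0.
by rewrite /= (_ : (j == Ordinal km) = false) ?mulr0 ?add0r//; exact/eqP/eqP.
Qed.

(** Along the polygonal line from x to x + h each increment of f is, by the mean
    value theorem, a coordinate of h times a partial derivative at a point near x;
    continuity replaces it by the partial derivative at x up to e * `|h|, and the m
    errors add up to o(h). *)
Lemma differentiable_of_partials U f : open U ->
  (forall i x, U x -> derivable f x (delta_mx 0 i)) ->
  (forall i x, U x -> {for x, continuous ('D_(delta_mx 0 i) f)}) ->
  forall x, U x -> differentiable f x.
Proof.
move=> oU df cf x Ux.
pose L (h : 'rV[R]_m) : R := \sum_i h 0 i * 'D_(delta_mx 0 i) f x.
have step (e : R) : 0 < e -> \forall h \near (0 : 'rV[R]_m), forall k : nat, (k <= m)%N ->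
    `|f (trunc_row k h + x) - f x
       - \sum_(i < m | (i < k)%N) h 0 i * 'D_(delta_mx 0 i) f x| <= k%:R * (e * `|h|).
  move=> e0.
  have : \forall y \near x, U y /\ forall i,
    `|'D_(delta_mx 0 i) f x - 'D_(delta_mx 0 i) f y| <= e.
    have nU : \forall y \near x, U y by exact: open_nbhs_nbhs.
    have nD : \forall y \near x, forall i,
      `|'D_(delta_mx 0 i) f x - 'D_(delta_mx 0 i) f y| <= e.
      apply: (@filter_forall _ _ (fun (i : 'I_m) (y : 'rV[R]_m) =>
        `|'D_(delta_mx 0 i) f x - 'D_(delta_mx 0 i) f y| <= e) (nbhs x) _) => i.
      by have /cvgrPdist_le /(_ e e0) := cf i x Ux.
    by near do split => //.
  move=> /nbhs_ballP[d /= d0 xd].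
  near=> h.
  have hd : `|h| < d by near: h; exact: (@nbhs0_lt _ 'rV[R]_m).
  elim=> [|k IH] km.
    have -> : trunc_row 0 h = 0 by apply/rowP => i; rewrite !mxE.
    by rewrite add0r subrr sub0r big_pred0// oppr0 normr0 mul0r.
  pose K := Ordinal km.
  have inB (t : R) : `|t| <= `|h 0 K| ->
      ball x d (t *: delta_mx 0 K + (trunc_row k h + x)).
    move=> th; rewrite -ball_normE /ball_ /= addrA opprD addrCA subrr addr0 normrN.
    apply: le_lt_trans hd; apply: row_norm_le => // i; rewrite !mxE eqxx andTb.
    case: ifPn => [ik|_].
      rewrite (_ : (i == K) = false) ?mulr0 ?add0r ?le_coord_norm//.
      by apply/eqP => iK; move: ik; rewrite iK ltnn.
    rewrite addr0; case: eqP => _; last by rewrite mulr0 normr0.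
    by rewrite mulr1 (le_trans th)// le_coord_norm.
  have [|c ch e1] := @mean_value_line R _ f (trunc_row k h + x) (delta_mx 0 K) (h 0 K).
    by move=> t th; apply: df; have [] := xd _ (inB t th).
  rewrite (trunc_rowS h km) -/K -[X in f X]addrA.
  rewrite (bigD1 K) /=; last by rewrite ltnS.
  rewrite (eq_bigl (fun i : 'I_m => (i < k)%N)); last first.
    move=> i; rewrite ltnS leq_eqVlt andb_orl -[X in X && _]/(i == K).
    by case: eqP => [->|_] /=; rewrite ?ltnn// andbT.
  have -> : f (h 0 K *: delta_mx 0 K + (trunc_row k h + x)) =
    h 0 K * 'D_(delta_mx 0 K) f (c *: delta_mx 0 K + (trunc_row k h + x))
     + f (trunc_row k h + x) by rewrite -e1 subrK.
  set S := \sum_(i < m | _) _.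
  set d1 := 'D_(delta_mx 0 K) f (c *: _ + _).
  have -> : h 0 K * d1 + f (trunc_row k h + x) - f x
      - (h 0 K * 'D_(delta_mx 0 K) f x + S) =
    (f (trunc_row k h + x) - f x - S) - h 0 K * ('D_(delta_mx 0 K) f x - d1) by ring.
  apply: le_trans (ler_normB _ _) _.
  rewrite -natr1 mulrDl mul1r lerD//; first by apply: IH; exact: ltnW.
  rewrite normrM mulrC; apply: ler_pM => //; last exact: le_coord_norm.
  by have [_] := xd _ (inB c ch); exact.
have Llin : linear L.
  move=> a u v; rewrite /L scaler_sumr -big_split; apply: eq_bigr => i _ /=.
  by rewrite !mxE mulrDl -mulrA.
pose LM := GRing.isLinear.Build _ _ _ _ _ Llin.
pose LL : {linear 'rV[R]_m -> R} := HB.pack L LM.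
have Lc : continuous LL.
  by move=> y; apply: differentiable_continuous; exact: linear_row_differentiable.
suff E : f \o shift x = cst (f x) + LL +o_ (0 : 'rV[R]_m) id.
  have := diff_unique Lc E => dE.
  by apply/diff_locallyP; rewrite dE; split.
apply/eqaddoP => e e0.
(* m.+1 instead of m: the dimension may be 0. *)
have em : 0 < e / m.+1%:R by rewrite divr_gt0.
near=> h.
have /(_ m (leqnn m)) : forall k : nat, (k <= m)%N ->
    `|f (trunc_row k h + x) - f x
       - \sum_(i < m | (i < k)%N) h 0 i * 'D_(delta_mx 0 i) f x| <= k%:R *
         (e / m.+1%:R * `|h|).
  by near: h; exact: step.
have -> : trunc_row m h = h by apply/rowP => i; rewrite mxE ltn_ord.
under eq_bigl do rewrite ltn_ord.
move=> le1; rewrite [X in `|X| <= _](_ : _ =  f (h + x) - f x - L h); last first.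
  by rewrite !fctE /= opprD addrA.
apply: (le_trans le1); rewrite mulrA ler_wpM2r// mulrCA ler_piMr ?(ltW e0)//.
by rewrite ler_pdivrMr// mul1r ler_nat.
Unshelve. all: by end_near. Qed.

End SmoothDifferentiable.

(** * The algebra of smooth functions *)

Lemma differentiable_near_eq (R : realType) (V W : normedModType R) (f g : V -> W) x :
  (\forall y \near x, f y = g y) -> differentiable f x -> differentiable g x.
Proof.
move=> fg df; have dc := @diff_continuous _ _ _ (nbhs_filter_on x) f df.
suff E : g \o shift x = cst (g x) + 'd f x +o_ (0 : V) id.
  have := diff_unique dc E => dE.
  by apply/diff_locallyP; rewrite dE; split.
apply/eqaddoP => e e0.
have /eqaddoP /(_ e e0) := diff_locally df.
have : \forall h \near (0 : V), f (h + x) = g (h + x).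
  by have := fg; rewrite (near_shift 0 x); apply: filterS => y /=; rewrite subr0.
apply: filterS2 => h; rewrite !fctE /= => ->.
by rewrite (nbhs_singleton fg).
Qed.

Lemma continuous_near_eq (R : realType) (V W : normedModType R) (f g : V -> W) x :
  (\forall y \near x, f y = g y) -> {for x, continuous f} -> {for x, continuous g}.
Proof.
move=> fg; rewrite /prop_for /continuous_at -(nbhs_singleton fg) => cf.
apply: cvg_trans cf; apply: near_eq_cvg; apply: filterS fg => y ->; by [].
Qed.

Lemma open_near_eq (T : topologicalType) (E : Type) (U : set T) (f g : T -> E) x :
  open U -> U x -> {in U, f =1 g} -> \forall y \near x, f y = g y.
Proof.
move=> oU Ux fg; have := open_nbhs_nbhs (conj oU Ux).
by apply: filterS => y Uy; apply: fg; rewrite inE.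
Qed.

Section SmoothScalar.
Context {R : realType}.

Section Basics.
Context {m : nat}.
Implicit Types (U : set 'rV[R]_m) (f g : 'rV[R]_m -> R).

Lemma iter_partial_rcons {V : normedModType R} s i (f : 'rV[R]_m -> V) :
  iter_partial (rcons s i) f = iter_partial s ('D_(delta_mx 0 i) f).
Proof. by rewrite /iter_partial foldr_rcons. Qed.

Lemma smooth_on_sub {V : normedModType R} U U' (f : 'rV[R]_m -> V) :
  U' `<=` U -> smooth_on U f -> smooth_on U' f.
Proof. by move=> UU sf s x /UU; exact: sf. Qed.

Lemma smooth_partial {V : normedModType R} U (f : 'rV[R]_m -> V) i :
  smooth_on U f -> smooth_on U ('D_(delta_mx 0 i) f).
Proof. by move=> sf s x Ux; rewrite -iter_partial_rcons; exact: sf. Qed.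

(** The derivative taken first stands last in the list of indices, hence the case
    analysis at the end of the list. *)
Lemma smooth_of_partials {V : normedModType R} U (f : 'rV[R]_m -> V) :
  (forall x, U x -> differentiable f x) ->
  (forall i, smooth_on U ('D_(delta_mx 0 i) f)) -> smooth_on U f.
Proof.
move=> df sf s x Ux; case/lastP: s => [|s i]; last first.
  by rewrite iter_partial_rcons; exact: sf.
split; first by apply: differentiable_continuous; exact: df.
by move=> i; apply: diff_derivable; exact: df.
Qed.

Lemma smooth_differentiable U f x :
  open U -> smooth_on U f -> U x -> differentiable f x.
Proof.
move=> oU sf; apply: differentiable_of_partials => // i y Uy.
  by have [_] := sf [::] y Uy; exact.
by have [] := sf [:: i] y Uy.
Qed.

Lemma smooth_cst U (c : R) : smooth_on U (cst c : 'rV[R]_m -> R).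
Proof.
move=> s x _.
have [c' ->] : exists c', iter_partial s (cst c) = cst c' :> ('rV[R]_m -> R).
  elim: s => [|i s [c' /= ->]]; first by exists c.
  by exists 0; apply/funext => y; rewrite derive_cst.
by split=> [|i]; [exact: cst_continuous|exact: derivable_cst].
Qed.

End Basics.

Section Expressions.
Context {m : nat}.
Implicit Types (U : set 'rV[R]_m) (f g : 'rV[R]_m -> R).

(** The derivative of a product, an inverse or a composite is a sum of products of such
    functions and of their derivatives. So the operations are treated together: the class
    that they generate is stable under derivation. *)
Inductive smooth_expr U : ('rV[R]_m -> R) -> Prop :=
| Expr_smooth f : smooth_on U f -> smooth_expr U f
| Expr_add f g : smooth_expr U f -> smooth_expr U g -> smooth_expr U (f \+ g)
| Expr_mul f g : smooth_expr U f -> smooth_expr U g -> smooth_expr U (f \* g)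
| Expr_inv f : (forall x, U x -> f x != 0) -> smooth_expr U f ->
    smooth_expr U (fun x => (f x)^-1)
| Expr_comp k (W : set 'rV[R]_k) (h : 'rV[R]_k -> R) (phi : 'rV[R]_m -> 'rV[R]_k) :
    open W -> smooth_on W h -> (forall j, smooth_on U (fun x => phi x 0 j : R)) ->
    (forall x, U x -> W (phi x)) -> smooth_expr U (h \o phi)
| Expr_ext f g : {in U, f =1 g} -> smooth_expr U f -> smooth_expr U g.

Lemma smooth_expr_sum U (I : Type) (r : seq I) (F : I -> 'rV[R]_m -> R) :
  (forall i, smooth_expr U (F i)) ->
  smooth_expr U (fun x => \sum_(i <- r) F i x).
Proof.
move=> sF; elim: r => [|i r IH].
  apply: (@Expr_ext _ (cst 0)); first by move=> x _; rewrite big_nil.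
  exact/Expr_smooth/smooth_cst.
apply: (@Expr_ext _ (F i \+ (fun x => \sum_(i <- r) F i x))).
  by move=> x _; rewrite big_cons.
exact: Expr_add.
Qed.

(** The rules of differential calculus, read as the statement that the class is stable
    under derivation. *)
Lemma smooth_expr_derive U f : open U -> smooth_expr U f ->
  (forall x, U x -> differentiable f x) /\ forall v, smooth_expr U ('D_v f).
Proof.
move=> oU; elim=> {f}.
- move=> f sf; have df x := smooth_differentiable oU sf (x := x).
  split=> // v.
  apply: (@Expr_ext _ (fun x => \sum_i v 0 i * 'D_(delta_mx 0 i) f x)).
    by move=> x; rewrite inE => Ux; rewrite (derive_basis _ (df _ Ux)).
  apply: smooth_expr_sum => i; apply: (@Expr_mul _ (cst (v 0 i))); apply: Expr_smooth.
    exact: smooth_cst.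
  exact: smooth_partial.
- move=> f g ef [df Df] eg [dg Dg]; split=> [x Ux|v].
    by apply: differentiableD; [exact: df|exact: dg].
  apply: (@Expr_ext _ ('D_v f \+ 'D_v g)); last exact: Expr_add.
  by move=> x; rewrite inE => Ux /=; rewrite deriveD//; apply: diff_derivable;
    [exact: df|exact: dg].
- move=> f g ef [df Df] eg [dg Dg]; split=> [x Ux|v].
    by apply: differentiableM; [exact: df|exact: dg].
  apply: (@Expr_ext _ ((f \* 'D_v g) \+ (g \* 'D_v f))); last first.
    by apply: Expr_add; exact: Expr_mul.
  by move=> x; rewrite inE => Ux /=; rewrite deriveM//; apply: diff_derivable;
    [exact: df|exact: dg].
- move=> f f0 ef [df Df]; split=> [x Ux|v].
    by apply: differentiableV; [exact: df|exact: f0].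
  pose fi x := (f x)^-1.
  apply: (@Expr_ext _ ((cst (-1) \* (fi \* fi)) \* 'D_v f)).
    move=> x; rewrite inE => Ux /=; rewrite deriveV ?f0//.
      by rewrite /fi /GRing.scale /=; field; exact: f0.
    by apply: diff_derivable; exact: df.
  apply: Expr_mul => //; apply: Expr_mul; first exact/Expr_smooth/smooth_cst.
  by apply: Expr_mul; exact: Expr_inv.
- move=> k W h phi oW sh sphi UW.
  have dphi x : U x -> differentiable phi x.
    by move=> Ux; apply: differentiable_rowP => j;
      exact: (smooth_differentiable oU (sphi j) Ux).
  have dh x : U x -> differentiable h (phi x).
    by move=> /UW Wx; exact: (smooth_differentiable oW sh Wx).
  split=> [x Ux|v]; first by apply: differentiable_comp; [exact: dphi|exact: dh].
  apply: (@Expr_ext _ (fun x => \sum_j 'D_v (fun x => phi x 0 j : R) x *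
      ('D_(delta_mx 0 j) h \o phi) x)).
    move=> x; rewrite inE => Ux /=; rewrite derive_chain; [|exact: dphi|exact: dh].
    rewrite (derive_basis _ (dh _ Ux)); apply: eq_bigr => j _.
    by rewrite derive_row_coord//; apply: diff_derivable; exact: dphi.
  apply: smooth_expr_sum => j; apply: Expr_mul; last first.
    exact: (Expr_comp oW (smooth_partial j sh) sphi UW).
  have sj := sphi j.
  apply: (@Expr_ext _ (fun x => \sum_i v 0 i * 'D_(delta_mx 0 i)
    (fun x => phi x 0 j : R) x)).
    by move=> x; rewrite inE => Ux; rewrite
      (derive_basis _ (smooth_differentiable oU sj Ux)).
  apply: smooth_expr_sum => i; apply: (@Expr_mul _ (cst (v 0 i))); apply: Expr_smooth.
    exact: smooth_cst.
  exact: smooth_partial.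
- move=> f g fg ef [df Df]; split=> [x Ux|v].
    by apply: differentiable_near_eq (df _ Ux); exact: open_near_eq fg.
  apply: Expr_ext (Df v) => x; rewrite inE => Ux.
  by apply: near_eq_derive; exact: open_near_eq fg.
Qed.

(** A class of differentiable functions which is stable under derivation consists of
    smooth functions, by induction on the number of derivatives. *)
Lemma smooth_expr_smooth U f : open U -> smooth_expr U f -> smooth_on U f.
Proof.
move=> oU ef s x Ux.
have : smooth_expr U (iter_partial s f).
  by elim: s => //= i s IH; have [_] := smooth_expr_derive oU IH; exact.
move=> /(smooth_expr_derive oU)[/(_ x Ux) d _]; split.
  exact: differentiable_continuous.
by move=> i; exact: diff_derivable.
Qed.

End Expressions.

Section Closure.
Context {m : nat} {U : set 'rV[R]_m} (oU : open U).
Implicit Types f g : 'rV[R]_m -> R.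

Lemma smooth_ext f g : smooth_on U f -> {in U, f =1 g} -> smooth_on U g.
Proof. by move=> sf fg; apply: smooth_expr_smooth => //; apply: Expr_ext fg _;
  exact: Expr_smooth. Qed.

Lemma smooth_add f g : smooth_on U f -> smooth_on U g -> smooth_on U (fun x => f x + g x).
Proof. by move=> sf sg; apply: smooth_expr_smooth => //; apply: Expr_add;
  exact: Expr_smooth. Qed.

Lemma smooth_mul f g : smooth_on U f -> smooth_on U g -> smooth_on U (fun x => f x * g x).
Proof. by move=> sf sg; apply: smooth_expr_smooth => //; apply: Expr_mul;
  exact: Expr_smooth. Qed.

Lemma smooth_inv f : (forall x, U x -> f x != 0) -> smooth_on U f ->
  smooth_on U (fun x => (f x)^-1).
Proof. by move=> f0 sf; apply: smooth_expr_smooth => //; apply: Expr_inv => //;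
  exact: Expr_smooth. Qed.

Lemma smooth_comp k (W : set 'rV[R]_k) (h : 'rV[R]_k -> R) (phi : 'rV[R]_m -> 'rV[R]_k) :
  open W -> smooth_on W h -> (forall j, smooth_on U (fun x => phi x 0 j : R)) ->
  (forall x, U x -> W (phi x)) -> smooth_on U (fun x => h (phi x)).
Proof. by move=> oW sh sphi UW; apply: smooth_expr_smooth => //; exact: (Expr_comp oW). Qed.

Lemma smooth_sum (I : Type) (r : seq I) (F : I -> 'rV[R]_m -> R) :
  (forall i, smooth_on U (F i)) -> smooth_on U (fun x => \sum_(i <- r) F i x).
Proof. by move=> sF; apply: smooth_expr_smooth => //; apply: smooth_expr_sum => i;
  exact: Expr_smooth. Qed.

Lemma smooth_prod (I : Type) (r : seq I) (F : I -> 'rV[R]_m -> R) :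
  (forall i, smooth_on U (F i)) -> smooth_on U (fun x => \prod_(i <- r) F i x).
Proof.
move=> sF; elim: r => [|i r IH].
  by apply: (smooth_ext (@smooth_cst _ U 1)) => x _; rewrite big_nil.
by apply: (smooth_ext (smooth_mul (sF i) IH)) => x _; rewrite big_cons.
Qed.

Lemma smooth_opp f : smooth_on U f -> smooth_on U (fun x => - f x).
Proof.
move=> sf; apply: (smooth_ext (smooth_mul (@smooth_cst _ U (-1)) sf)) => x _.
by rewrite /= mulN1r.
Qed.

Lemma smooth_coord j : smooth_on U (fun x => x 0 j : R).
Proof.
apply: smooth_of_partials => [x _|i]; first exact: differentiable_coord.
apply: (smooth_ext (@smooth_cst _ U ((delta_mx 0 i : 'rV[R]_m) 0 j))) => x _ /=.
by rewrite -(@derive_row_coord R _ m id)// derive_id.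
Qed.

Lemma smooth_derive f v : smooth_on U f -> smooth_on U ('D_v f).
Proof.
move=> sf; apply: smooth_expr_smooth => //.
by have [_] := smooth_expr_derive oU (Expr_smooth sf); exact.
Qed.

Lemma smooth_directional f (X : 'rV[R]_m -> 'rV[R]_m) : smooth_on U f ->
  (forall j, smooth_on U (fun x => X x 0 j : R)) -> smooth_on U (fun x => 'D_(X x) f x).
Proof.
move=> sf sX; apply: (@smooth_ext (fun x => \sum_i X x 0 i * 'D_(delta_mx 0 i) f x)).
  by apply: smooth_sum => i; apply: smooth_mul; [exact: sX|exact: smooth_partial].
by move=> x; rewrite inE => Ux; rewrite (derive_basis _ (smooth_differentiable oU sf Ux)).
Qed.

Lemma smooth_linear k (L : {linear 'rV[R]_m -> 'rV[R]_k}) j :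
  smooth_on U (fun x => L x 0 j : R).
Proof.
apply: (@smooth_ext (fun x => \sum_i x 0 i * (L (delta_mx 0 i) 0 j))).
  by apply: smooth_sum => i; apply: smooth_mul; [exact: smooth_coord|exact: smooth_cst].
move=> x _; rewrite {2}[x]row_sum_delta linear_sum summxE.
by apply: eq_bigr => i _; rewrite linearZ mxE.
Qed.

End Closure.
End SmoothScalar.

(** * Symmetry of second derivatives *)

Section Schwarz.
Context {R : realType} {m : nat}.
Implicit Types (U : set 'rV[R]_m) (f : 'rV[R]_m -> R).

(** The second difference of f over the parallelogram with sides s *: u and s *: v:
    the mean value theorem is applied first to f (s *: v + y) - f y in the direction
    u, then to the derivative of f along u in the direction v. *)
Lemma second_difference U f x u v (d s : R) : open U -> smooth_on U f ->
  ball x d `<=` U -> 0 <= s -> s * (`|u| + `|v|) < d ->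
  exists2 y, ball x d y &
    f (s *: v + (s *: u + x)) - f (s *: u + x) - (f (s *: v + x) - f x) =
      s * (s * 'D_v ('D_u f) y).
Proof.
move=> oU sf xU s0 sd.
have inB (a b : R) : `|a| <= `|s| -> `|b| <= `|s| -> ball x d (b *: v + (a *: u + x)).
  rewrite (ger0_norm s0) => As Bs.
  rewrite -ball_normE /ball_ /= addrA opprD addrCA subrr addr0 normrN.
  apply: le_lt_trans sd; rewrite mulrDr addrC; apply: le_trans (ler_normD _ _) _.
  by rewrite !normrZ lerD// ler_wpM2r.
have inU a b As Bs := xU _ (inB a b As Bs).
have dD y : U y -> differentiable f y by exact: smooth_differentiable.
pose sh (y : 'rV[R]_m) := s *: v + y.
have dsh y : differentiable sh y.
  by apply: differentiableD; [exact: differentiable_cst|exact: ex_diff].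
have z0 : `|0 : R| <= `|s| by rewrite normr0.
have u0 a : `|a| <= `|s| -> U (a *: u + x).
  by move=> As; have := inU a 0 As z0; rewrite scale0r add0r.
have dfsh a : `|a| <= `|s| -> differentiable (f \o sh) (a *: u + x).
  by move=> As; apply: differentiable_comp (dsh _) _; apply: dD; exact: inU.
have [a As e1] : exists2 a, `|a| <= `|s| &
   (f \o sh - f) (s *: u + x) - (f \o sh - f) x = s * 'D_u (f \o sh - f) (a *: u + x).
  apply: (@mean_value_line _ _ (f \o sh - f) x u s) => t ts; apply: derivableB;
    apply: diff_derivable.
    exact: dfsh.
  by apply: dD; exact: u0.
have e2 : 'D_u (f \o sh - f) (a *: u + x) =
  'D_u f (s *: v + (a *: u + x)) - 'D_u f (a *: u + x).
  rewrite deriveB; [|by apply: diff_derivable; exact: dfsh|by apply: diff_derivable;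
    apply: dD; exact: u0].
  by rewrite (@derive_affine_comp _ _ _ _ f sh _ u u)// => h; rewrite /sh addrCA.
have [b Bs e3] : exists2 b, `|b| <= `|s| &
   'D_u f (s *: v + (a *: u + x)) - 'D_u f (a *: u + x) =
     s * 'D_v ('D_u f) (b *: v + (a *: u + x)).
  apply: (@mean_value_line _ _ ('D_u f) (a *: u + x) v s) => t ts; apply: diff_derivable.
  apply: (smooth_differentiable oU (smooth_derive oU u sf)); exact: inU.
exists (b *: v + (a *: u + x)); first exact: inB.
by rewrite -e3 -e2 -e1.
Qed.

Lemma eq_of_near_values {V : normedModType R} (A B : V -> R) x :
  {for x, continuous A} -> {for x, continuous B} ->
  (forall d : R, 0 < d -> exists y1 y2, [/\ ball x d y1, ball x d y2 & A y1 = B y2]) ->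
  A x = B x.
Proof.
move=> /cvgrPdist_le cA /cvgrPdist_le cB AB.
apply/eqP; rewrite -subr_eq0 -normr_le0; apply/ler_addgt0Pl => e e0; rewrite addr0.
have e2 : 0 < e / 2 by rewrite divr_gt0.
have /nbhs_ballP[d1 /= d10 H1] := cA _ e2.
have /nbhs_ballP[d2 /= d20 H2] := cB _ e2.
have [|y1 [y2 [By1 By2 E]]] := AB (Num.min d1 d2); first by rewrite lt_min d10.
have {}By1 : ball x d1 y1 by apply: le_ball By1; rewrite ge_min lexx.
have {}By2 : ball x d2 y2 by apply: le_ball By2; rewrite ge_min lexx orbT.
have -> : A x - B x = (A x - A y1) - (B x - B y2) by rewrite E; ring.
by rewrite (le_trans (ler_normB _ _))// [leRHS]splitr lerD//; [exact: H1|exact: H2].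
Qed.

(** The second difference is symmetric in u and v, so the two iterated derivatives
    take a common value at points arbitrarily close to x; continuity concludes. *)
Lemma schwarz U f x u v : open U -> smooth_on U f -> U x ->
  'D_v ('D_u f) x = 'D_u ('D_v f) x.
Proof.
move=> oU sf Ux.
have cts a b : {for x, continuous ('D_a ('D_b f))}.
  apply: differentiable_continuous.
  exact: (smooth_differentiable oU (smooth_derive oU a (smooth_derive oU b sf)) Ux).
apply: (eq_of_near_values (cts v u) (cts u v)) => d' d'0.
have /nbhs_ballP[d'' /= d''0 xU'] := open_nbhs_nbhs (conj oU Ux).
pose d := Num.min d' d''; have d0 : 0 < d by rewrite lt_min d'0.
have xU : ball x d `<=` U.
  by apply: subset_trans xU'; apply: le_ball; rewrite ge_min lexx orbT.
have dd' : ball x d `<=` ball x d' by apply: le_ball; rewrite ge_min lexx.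
(* The 1 keeps the denominator positive when u and v vanish. *)
pose s := d / (2 * (`|u| + `|v| + 1)).
have w0 : 0 < `|u| + `|v| + 1 by rewrite ltr_wpDl// addr_ge0.
have s0 : 0 < s by rewrite /s divr_gt0// mulr_gt0.
have sd : s * (`|u| + `|v|) < d.
  rewrite /s mulrAC ltr_pdivrMr ?mulr_gt0//.
  rewrite ltr_pM2l//; lra.
have sd' : s * (`|v| + `|u|) < d by rewrite [`|v| + _]addrC.
have [y1 By1 E1] := second_difference oU sf xU (ltW s0) sd.
have [y2 By2 E2] := second_difference oU sf xU (ltW s0) sd'.
exists y1, y2; split; [exact: dd'|exact: dd'|].
apply: (mulfI (lt0r_neq0 s0)); apply: (mulfI (lt0r_neq0 s0)).
(* The two second differences are the same four values of f in another order. *)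
have swap (a b c e : R) : a - b - (c - e) = a - c - (b - e) by ring.
apply: etrans (esym E1) _; apply: etrans _ E2.
by rewrite [s *: v + (_ + _)]addrCA; exact: swap.
Qed.

End Schwarz.

(** * Smooth maps into row vectors *)

Section SmoothRow.
Context {R : realType} {m k : nat}.
Implicit Types (U : set 'rV[R]_m) (phi : 'rV[R]_m -> 'rV[R]_k).

Lemma iter_partial_row U phi s : open U ->
  (forall j, smooth_on U (fun x => phi x 0 j : R)) ->
  {in U, iter_partial s phi =1 fun x => \row_j iter_partial s (fun x => phi x 0 j : R) x}.
Proof.
move=> oU sphi; elim: s => [|i s IH] x; rewrite inE => Ux.
  by apply/rowP => j; rewrite mxE.
rewrite /= (near_eq_derive _ (open_near_eq oU Ux IH)); apply/rowP => j; rewrite mxE.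
rewrite derive_row_coord.
  by apply: near_eq_derive; apply: (open_near_eq oU Ux) => y _; rewrite mxE.
apply/derivable_mxP => a b; rewrite ord1.
have [_ /(_ i)] := sphi b s x Ux; apply: near_eq_derivable.
by apply: (open_near_eq oU Ux) => y _; rewrite mxE.
Qed.

(** Iterated partial derivatives of a map into row vectors are computed coordinate by
    coordinate, which reduces all questions about such maps to scalar functions. *)
Lemma smooth_rowP U phi : open U ->
  smooth_on U phi <-> forall j, smooth_on U (fun x => phi x 0 j : R).
Proof.
move=> oU; split=> [sphi j|sphi s x Ux]; last first.
  have e := iter_partial_row s oU sphi.
  have es y : y \in U -> (fun x => \row_j iter_partial s (fun x => phi x 0 j : R) x) y =
    iter_partial s phi y.
    by move=> /e.
  have d : differentiable (fun x => \row_j iter_partial s (fun x => phi x 0 j : R) x) x.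
    apply: differentiable_rowP => j.
    have sj : smooth_on U (iter_partial s (fun x => phi x 0 j : R)).
      elim: s {e es} => [|i s IH]; first exact: sphi.
      exact: (@smooth_derive _ _ U).
    have ej : {in U, iter_partial s (fun x => phi x 0 j : R) =1
        fun x => (\row_j iter_partial s (fun x => phi x 0 j : R) x) 0 j}.
      by move=> y _; rewrite mxE.
    exact: (differentiable_near_eq (open_near_eq oU Ux ej)
      (smooth_differentiable oU sj Ux)).
  have d' := differentiable_near_eq (open_near_eq oU Ux es) d.
  by split=> [|i]; [exact: differentiable_continuous|exact: diff_derivable].
have E s : {in U, iter_partial s (fun x => phi x 0 j : R) =1 fun x => iter_partial s phi
  x 0 j}.
  elim: s => [|i s IH] x; rewrite inE => Ux //=.
  have [_ /(_ i) d] := sphi s x Ux.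
  by rewrite derive_row_coord//; apply: near_eq_derive; exact: open_near_eq IH.
move=> s x Ux; have [c d] := sphi s x Ux; have {E}E := E s.
have E' : \forall y \near x, iter_partial s phi y 0 j =
  iter_partial s (fun x => phi x 0 j : R) y.
  by apply: (open_near_eq oU Ux) => y /E.
split.
  apply: (continuous_near_eq E').
  exact: (@continuous_comp _ _ _ (iter_partial s phi) (fun M : 'rV[R]_k => M 0 j) x c
    (@coord_continuous _ _ _ _ _ _)).
move=> i; apply: near_eq_derivable E' _.
by have /derivable_mxP := d i; exact.
Qed.

Lemma smooth_row_differentiable U phi x : open U -> smooth_on U phi -> U x ->
  differentiable phi x.
Proof.
move=> oU /smooth_rowP - /(_ oU) sphi Ux; apply: differentiable_rowP => j.
exact: smooth_differentiable oU (sphi j) Ux.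
Qed.

Lemma smooth_row_ext U phi psi : open U -> smooth_on U phi -> {in U, phi =1 psi} ->
  smooth_on U psi.
Proof.
move=> oU sphi E; apply/(smooth_rowP _ oU) => j.
have sj := (smooth_rowP _ oU).1 sphi j.
by apply: (smooth_ext oU sj) => x Ux; rewrite E.
Qed.

Lemma smooth_row_add U phi psi : open U -> smooth_on U phi -> smooth_on U psi ->
  smooth_on U (fun x => phi x + psi x).
Proof.
move=> oU sphi spsi; apply/(smooth_rowP _ oU) => j.
have s := smooth_add oU ((smooth_rowP _ oU).1 sphi j) ((smooth_rowP _ oU).1 spsi j).
by apply: (smooth_ext oU s) => x Ux; rewrite mxE.
Qed.

Lemma smooth_row_opp U phi : open U -> smooth_on U phi ->
  smooth_on U (fun x => - phi x).
Proof.
move=> oU sphi; apply/(smooth_rowP _ oU) => j.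
have s := smooth_opp oU ((smooth_rowP _ oU).1 sphi j).
by apply: (smooth_ext oU s) => x Ux; rewrite mxE.
Qed.

Lemma smooth_row_cst U (c : 'rV[R]_k) : open U ->
  smooth_on U (cst c : 'rV[R]_m -> 'rV[R]_k).
Proof. by move=> oU; apply/(smooth_rowP _ oU) => j; exact: (smooth_cst (c 0 j)). Qed.

End SmoothRow.

Lemma smooth_row_mx {R : realType} {m k l : nat} (U : set 'rV[R]_m)
    (phi : 'rV[R]_m -> 'rV[R]_k) (psi : 'rV[R]_m -> 'rV[R]_l) :
  open U -> smooth_on U phi -> smooth_on U psi ->
  smooth_on U (fun x => row_mx (phi x) (psi x)).
Proof.
move=> oU sphi spsi; apply/(smooth_rowP _ oU) => j; case: (split_ordP j) => i ->.
  by apply: (smooth_ext oU ((smooth_rowP _ oU).1 sphi i)) => x Ux; rewrite row_mxEl.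
by apply: (smooth_ext oU ((smooth_rowP _ oU).1 spsi i)) => x Ux; rewrite row_mxEr.
Qed.

Lemma smooth_row_linear {R : realType} {m k l : nat} (U : set 'rV[R]_m)
    (phi : 'rV[R]_m -> 'rV[R]_k) (L : {linear 'rV[R]_k -> 'rV[R]_l}) :
  open U -> smooth_on U phi -> smooth_on U (fun x => L (phi x)).
Proof.
move=> oU sphi; apply/(smooth_rowP _ oU) => j.
exact: (smooth_comp oU openT (smooth_linear openT L j) ((smooth_rowP _ oU).1 sphi)).
Qed.

(** * The Lie bracket in coordinates *)

Section Bracket.
Context {R : realType} {m : nat} (U : set 'rV[R]_m) (oU : open U).
Implicit Types (X Y : 'rV[R]_m -> 'rV[R]_m).

(** The product rule for sum_i X_i D_i f: either the coefficients X or the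
    partial derivatives of f are differentiated. *)
Lemma derive_directional (f : 'rV[R]_m -> R) X x v :
  smooth_on U f -> smooth_on U X -> U x ->
  'D_v (fun y => 'D_(X y) f y) x = 'D_('D_v X x) f x + 'D_v ('D_(X x) f) x.
Proof.
move=> sf sX Ux; have sX' := (smooth_rowP _ oU).1 sX.
have df y : U y -> differentiable f y by exact: smooth_differentiable.
have dDf i y : U y -> differentiable ('D_(delta_mx 0 i) f) y.
  by move=> Uy; apply: smooth_differentiable (oU) _ Uy; exact: smooth_partial.
have dX y : U y -> differentiable X y by exact: smooth_row_differentiable.
have dXi i y : U y -> differentiable (fun y => X y 0 i : R) y.
  by move=> Uy; exact: (smooth_differentiable oU (sX' i) Uy).
pose h i : 'rV[R]_m -> R := (fun y => X y 0 i : R) * 'D_(delta_mx 0 i) f.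
have E : {in U, (fun y => 'D_(X y) f y) =1 \sum_i h i}.
  move=> y; rewrite inE => Uy.
  by rewrite (derive_basis _ (df _ Uy)) fct_sumE.
apply: etrans (near_eq_derive _ (open_near_eq oU Ux E)) _.
rewrite derive_sum; last first.
  by move=> i; apply: derivableM; apply: diff_derivable; [exact: dXi|exact: dDf].
have -> : 'D_v ('D_(X x) f) x = \sum_i X x 0 i * 'D_v ('D_(delta_mx 0 i) f) x.
  have sv : smooth_on U ('D_v f) by exact: smooth_derive.
  rewrite (schwarz _ _ oU sf Ux) (derive_basis _ (smooth_differentiable oU sv Ux)).
  by apply: eq_bigr => i _; rewrite (schwarz _ _ oU sf Ux).
rewrite (derive_basis _ (df _ Ux)) -big_split; apply: eq_bigr => i _ /=.
rewrite deriveM; [|by apply: diff_derivable; exact: dXi|by apply: diff_derivable;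
  exact: dDf].
rewrite derive_row_coord; last by apply: diff_derivable; exact: dX.
by rewrite addrC; congr (_ + _); exact: mulrC.
Qed.

(** In the difference of the two products of derivations the second derivatives of f
    cancel by symmetry, and only the derivatives of the coefficients remain. *)
Lemma derive_bracket (f : 'rV[R]_m -> R) X Y x :
  smooth_on U f -> smooth_on U X -> smooth_on U Y -> U x ->
  'D_('D_(X x) Y x - 'D_(Y x) X x) f x =
    'D_(X x) (fun y => 'D_(Y y) f y) x - 'D_(Y x) (fun y => 'D_(X y) f y) x.
Proof.
move=> sf sX sY Ux.
have E1 := derive_directional (X x) sf sY Ux.
have E2 := derive_directional (Y x) sf sX Ux.
have sw := schwarz (Y x) (X x) oU sf Ux.
have cancel (a p b q : R) : p = q -> a - b = (a + p) - (b + q) by move=> ->; ring.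
have df : differentiable f x by exact: (smooth_differentiable oU sf Ux).
have E0 : 'D_('D_(X x) Y x - 'D_(Y x) X x) f x =
  'D_('D_(X x) Y x) f x - 'D_('D_(Y x) X x) f x by rewrite !(deriveE _ df) linearB.
apply: (etrans E0); apply: (etrans (cancel _ _ _ _ sw)).
exact: (esym (f_equal2 (fun a b : R => a - b) E1 E2)).
Qed.

End Bracket.

Section BracketRow.
Context {R : realType} {m k : nat} (U : set 'rV[R]_m) (oU : open U).
Implicit Types (X Y : 'rV[R]_m -> 'rV[R]_m) (phi : 'rV[R]_m -> 'rV[R]_k).

Lemma derive_coord_in phi X j : smooth_on U phi ->
  {in U, (fun y => ('D_(X y) phi y) 0 j) =1 fun y => 'D_(X y) (fun y => phi y 0 j : R) y}.
Proof.
move=> sphi y; rewrite inE => Uy; apply: derive_row_coord; apply: diff_derivable.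
exact: (smooth_row_differentiable oU sphi Uy).
Qed.

Lemma smooth_directional_row phi X : smooth_on U phi -> smooth_on U X ->
  smooth_on U (fun y => 'D_(X y) phi y).
Proof.
move=> sphi sX; apply/(smooth_rowP _ oU) => j.
have sj := (smooth_rowP _ oU).1 sphi j; have sXj := (smooth_rowP _ oU).1 sX.
apply: (smooth_ext oU (smooth_directional oU sj sXj)) => y Uy.
exact: esym (derive_coord_in X j sphi Uy).
Qed.

Lemma derive_bracket_row phi X Y x :
  smooth_on U phi -> smooth_on U X -> smooth_on U Y -> U x ->
  'D_('D_(X x) Y x - 'D_(Y x) X x) phi x =
    'D_(X x) (fun y => 'D_(Y y) phi y) x - 'D_(Y x) (fun y => 'D_(X y) phi y) x.
Proof.
move=> sphi sX sY Ux; apply/rowP => j; rewrite mxE [X in _ = _ + X]mxE.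
have sj := (smooth_rowP _ oU).1 sphi j.
have dphi : differentiable phi x by exact: (smooth_row_differentiable oU sphi Ux).
have E Z v : smooth_on U Z -> ('D_v (fun y => 'D_(Z y) phi y) x) 0 j =
    'D_v (fun y => 'D_(Z y) (fun y => phi y 0 j : R) y) x.
  move=> sZ; have sD := smooth_directional_row sphi sZ.
  apply: etrans (derive_row_coord _ (diff_derivable
    (smooth_row_differentiable oU sD Ux))) _.
  exact: (near_eq_derive _ (open_near_eq oU Ux (derive_coord_in Z j sphi))).
apply: (etrans (derive_row_coord _ (diff_derivable dphi))).
apply: (etrans (derive_bracket oU sj sX sY Ux)).
by apply: f_equal2; [exact: esym (E _ _ sY)|apply: congr1; exact: esym (E _ _ sX)].
Qed.

End BracketRow.

(** * Atlases with smooth changes of charts *)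

Section SmoothAtlas.
Context {R : realType} {m : nat} {N : Type} (A : atlas R m N).

Definition overlap (a b : chart A) : set 'rV[R]_m :=
  chart_coord a @` (chart_dom a `&` chart_dom b).

Definition transition (a b : chart A) : 'rV[R]_m -> 'rV[R]_m :=
  local_rep a (chart_coord b).

Lemma local_rep_coord {V : normedModType R} (a : chart A) (f : N -> V) p :
  (forall q, chart_dom a q -> chart_coord a q = chart_coord a p -> q = p) ->
  chart_dom a p -> local_rep a f (chart_coord a p) = f p.
Proof.
move=> inj ap; rewrite /local_rep; case: pselect => [e|]; last by case; exists p.
by case: (cid e) => q [aq E] /=; rewrite (inj q aq E).
Qed.

(** The properties common to the atlas of a manifold and to the induced atlas of its
    slit tangent bundle. Derivatives, brackets and components in charts depend on N
    through these properties alone. *)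
Record smooth_atlas : Prop := SmoothAtlas {
  atlas_at : forall p, chart_dom (chart_at A p) p;
  atlas_inj : forall (a : chart A) p q, chart_dom a p -> chart_dom a q ->
    chart_coord a p = chart_coord a q -> p = q;
  atlas_open : forall a b, open (overlap a b);
  atlas_smooth : forall a b, smooth_on (overlap a b) (transition a b) }.

Hypothesis hA : smooth_atlas.
Implicit Types (a b : chart A) (p : N).

Lemma overlap_mem a b p : chart_dom a p -> chart_dom b p -> overlap a b (chart_coord a p).
Proof. by move=> ap bp; exists p. Qed.

Lemma chart_image_mem a p : chart_dom a p -> chart_image a (chart_coord a p).
Proof. by move=> ap; exists p. Qed.

Lemma overlap_image a b : overlap a b `<=` chart_image a.
Proof. by move=> _ [p [ap _] <-]; exists p. Qed.

Lemma chart_image_open a : open (chart_image a).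
Proof. by have := @atlas_open hA a a; rewrite /overlap setIid. Qed.

Lemma local_repE {V : normedModType R} a (f : N -> V) p :
  chart_dom a p -> local_rep a f (chart_coord a p) = f p.
Proof. by move=> ap; apply: local_rep_coord => // q aq; exact: (atlas_inj hA). Qed.

Lemma local_rep_change {V : normedModType R} a b (f : N -> V) :
  {in overlap a b, local_rep b f \o transition a b =1 local_rep a f}.
Proof.
move=> x; rewrite inE => -[p [ap bp] <-] /=.
by rewrite /transition !local_repE.
Qed.

Lemma transition_differentiable a b p : chart_dom a p -> chart_dom b p ->
  differentiable (transition a b) (chart_coord a p).
Proof.
move=> ap bp; apply: (smooth_row_differentiable (@atlas_open hA a b)
  (@atlas_smooth hA a b)).
exact: overlap_mem.
Qed.

Lemma derive_change {V : normedModType R} a b (f : N -> V) p v :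
  chart_dom a p -> chart_dom b p ->
  differentiable (local_rep b f) (chart_coord b p) ->
  'D_v (local_rep a f) (chart_coord a p) =
    'D_('D_v (transition a b) (chart_coord a p)) (local_rep b f) (chart_coord b p).
Proof.
move=> ap bp df.
have T : transition a b (chart_coord a p) = chart_coord b p by exact: local_repE.
have df' : differentiable (local_rep b f) (transition a b (chart_coord a p)) by rewrite T.
rewrite -T; apply: (etrans _ (derive_chain _ (transition_differentiable ap bp) df')).
apply: esym; apply: near_eq_derive.
exact: (open_near_eq (@atlas_open hA a b) (overlap_mem ap bp) (local_rep_change _)).
Qed.

(** Directional derivatives are defined with the preferred chart at p; by the chain rule
    any other chart around p gives the same value, which allows p to vary. *)
Lemma dirder_chart {V : normedModType R} a (f : N -> V) p (v : tangent A p) :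
  chart_dom a p -> differentiable (local_rep a f) (chart_coord a p) ->
  dirder f v = 'D_(component a v) (local_rep a f) (chart_coord a p).
Proof. by move=> ap df; apply: derive_change => //; exact: atlas_at. Qed.

Lemma component_change a b p (v : tangent A p) : chart_dom a p -> chart_dom b p ->
  component b v = 'D_(component a v) (transition a b) (chart_coord a p).
Proof.
by move=> ap bp; apply: (@dirder_chart _ a (chart_coord b)) => //;
  exact: transition_differentiable.
Qed.

Lemma transition_id a : {in chart_image a, transition a a =1 id}.
Proof. by move=> x; rewrite inE => -[q aq <-]; exact: local_repE. Qed.

Lemma component_at p (v : tangent A p) : component (chart_at A p) v = v.
Proof.
have pp := atlas_at hA p.
apply: (etrans _ (derive_id (chart_coord (chart_at A p) p) v)).
exact: (near_eq_derive _ (open_near_eq (@chart_image_open _) (chart_image_mem pp)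
  (@transition_id _))).
Qed.

Lemma componentP a p (c : R) (u v : tangent A p) : chart_dom a p ->
  component a (c *: u + v) = c *: component a u + component a v.
Proof.
move=> ap; apply: derive_linear; apply: transition_differentiable => //.
exact: atlas_at.
Qed.

Lemma component0 a p : component a (0 : tangent A p) = 0.
Proof. exact: derive0. Qed.

Lemma componentD a p (u v : tangent A p) : chart_dom a p ->
  component a (u + v) = component a u + component a v.
Proof. by move=> ap; rewrite -[u]scale1r componentP// !scale1r. Qed.

Lemma componentZ a p (c : R) (u : tangent A p) : chart_dom a p ->
  component a (c *: u) = c *: component a u.
Proof. by move=> ap; have := componentP c u 0 ap; rewrite addr0 component0 addr0. Qed.

Lemma componentN a p (u : tangent A p) : chart_dom a p ->
  component a (- u) = - component a u.
Proof. by move=> ap; rewrite -scaleN1r componentZ// scaleN1r. Qed.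

(** The tangent vector with prescribed components in the chart a: its components in the
    preferred chart at p are obtained by the differential of the change of charts. *)
Definition of_component a p (w : 'rV[R]_m) : tangent A p :=
  'D_w (transition a (chart_at A p)) (chart_coord a p).

Lemma component_of_component a p w : chart_dom a p ->
  component a (of_component a p w) = w.
Proof.
move=> ap; have pp := atlas_at hA p.
apply: (etrans (esym (derive_change w ap pp (transition_differentiable pp ap)))).
apply: (etrans _ (derive_id (chart_coord a p) w)).
exact: (near_eq_derive _ (open_near_eq (@chart_image_open _) (chart_image_mem ap)
  (@transition_id _))).
Qed.

Lemma component_inj a p (v w : tangent A p) : chart_dom a p ->
  component a v = component a w -> v = w.
Proof.
move=> ap; have pp := atlas_at hA p => E.
by rewrite -(component_at v) -(component_at w)
  (component_change v ap pp) E -component_change.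
Qed.

Section Fields.
Variables (X Y : vector_field A).
Hypotheses (sX : smooth_vf X) (sY : smooth_vf Y).

Lemma vf_repE a (Z : vector_field A) p : chart_dom a p ->
  vf_rep a Z (chart_coord a p) = component a (Z p).
Proof. exact: local_repE. Qed.

Lemma vf_rep_change a b (Z : vector_field A) :
  {in overlap a b, (fun x => 'D_(vf_rep a Z x) (transition a b) x) =1
                   vf_rep b Z \o transition a b}.
Proof.
move=> x; rewrite inE => -[p [ap bp] <-] /=.
by rewrite vf_repE// -component_change// /transition local_repE// vf_repE.
Qed.

(** The change of charts phi from the preferred chart at p to b carries the coordinates of
    fields by its differential. The derivative of phi along the bracket is the commutator
    of the two derivations applied to phi, and deriving phi along a field yields the
    components of that field in b. *)
Lemma lie_bracket_component b p : chart_dom b p ->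
  component b (lie_bracket X Y p) =
    'D_(component b (X p)) (vf_rep b Y) (chart_coord b p)
    - 'D_(component b (Y p)) (vf_rep b X) (chart_coord b p).
Proof.
move=> bp; have pp := atlas_at hA p; set a := chart_at A p.
have oW := @atlas_open hA a b; have Wp := overlap_mem pp bp : overlap a b _.
have sW Z : smooth_vf Z -> smooth_on (overlap a b) (vf_rep a Z).
  by move=> sZ; apply: smooth_on_sub (sZ a); exact: overlap_image.
have aX Z : vf_rep a Z (chart_coord a p) = Z p by rewrite vf_repE// component_at.
have T : transition a b (chart_coord a p) = chart_coord b p by exact: local_repE.
have dt : differentiable (transition a b) (chart_coord a p) by exact:
  transition_differentiable.
have E Z Z' : smooth_vf Z' ->
    'D_(vf_rep a Z (chart_coord a p))
      (fun x => 'D_(vf_rep a Z' x) (transition a b) x) (chart_coord a p) =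
    'D_(component b (Z p)) (vf_rep b Z') (chart_coord b p).
  move=> sZ'; apply: (etrans (near_eq_derive _ (open_near_eq oW Wp (vf_rep_change _)))).
  have d : differentiable (vf_rep b Z') (transition a b (chart_coord a p)).
    by rewrite T; exact: (smooth_row_differentiable (@chart_image_open b) (sZ' b)
      (chart_image_mem bp)).
  have c1 := derive_chain (vf_rep a Z (chart_coord a p)) dt d.
  have c2 : 'D_(vf_rep a Z (chart_coord a p)) (transition a b) (chart_coord a p) =
      component b (Z p).
    by rewrite (vf_repE Z pp) -(component_change (Z p) pp bp).
  exact: (etrans c1 (f_equal2 (fun z v => 'D_v (vf_rep b Z') z) T c2)).
have B := derive_bracket_row oW (@atlas_smooth hA a b) (sW X sX) (sW Y sY) Wp.
have L : lie_bracket X Y p =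
    'D_(vf_rep a X (chart_coord a p)) (vf_rep a Y) (chart_coord a p)
    - 'D_(vf_rep a Y (chart_coord a p)) (vf_rep a X) (chart_coord a p).
  exact: esym (f_equal2 (fun v w => 'D_v (vf_rep a Y) (chart_coord a p)
    - 'D_w (vf_rep a X) (chart_coord a p)) (aX X) (aX Y)).
apply: (etrans (congr1 (@component _ _ _ A b p) L)); apply: (etrans B).
exact: (f_equal2 (fun v w => v - w) (E X Y sY) (E Y X sX)).
Qed.

(** The preferred chart changes with the point, so the defining formula does not show
    smoothness; the formula valid in a fixed chart does. *)
Lemma smooth_lie_bracket : smooth_vf (lie_bracket X Y).
Proof.
move=> b; have oI := @chart_image_open b.
have s1 := smooth_directional_row oI (@sY b) (@sX b).
have s2 := smooth_directional_row oI (@sX b) (@sY b).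
apply/(smooth_rowP _ oI) => j.
have := smooth_add oI ((smooth_rowP _ oI).1 s1 j)
  (smooth_opp oI ((smooth_rowP _ oI).1 s2 j)).
move=> s; apply: (smooth_ext oI s) => x; rewrite inE => -[p bp <-].
by rewrite [in RHS]vf_repE// lie_bracket_component// !vf_repE// mxE [X in _ = _ + X]mxE.
Qed.

Lemma smooth_map_differentiable (f : N -> R^o) a p : smooth_map A f -> chart_dom a p ->
  differentiable (local_rep a f) (chart_coord a p).
Proof.
move=> sf ap; exact: (smooth_differentiable (@chart_image_open a) (sf a)
  (chart_image_mem ap)).
Qed.

(** In a fixed chart the derivative of f along Z is the coordinate expression of Z applied
    to the coordinate expression of f, although at each point it is defined by another
    chart. *)
Lemma dirder_rep (f : N -> R^o) a (Z : vector_field A) : smooth_map A f ->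
  {in chart_image a, local_rep a (fun q => dirder f (Z q)) =1
     fun x => 'D_(vf_rep a Z x) (local_rep a f) x}.
Proof.
move=> sf x; rewrite inE => -[q aq <-].
rewrite [LHS]local_repE// vf_repE//; apply: dirder_chart => //.
exact: smooth_map_differentiable.
Qed.

Lemma dirder_lie_bracket (f : N -> R^o) p : smooth_map A f ->
  dirder f (lie_bracket X Y p) =
    dirder (fun q => dirder f (Y q)) (X p) - dirder (fun q => dirder f (X q)) (Y p).
Proof.
move=> sf; have pp := atlas_at hA p; set a := chart_at A p.
have oI := @chart_image_open a; have Ip := chart_image_mem pp : chart_image a _.
have aX Z : vf_rep a Z (chart_coord a p) = Z p by rewrite vf_repE// component_at.
have E Z v := near_eq_derive v (open_near_eq oI Ip (dirder_rep Z sf)).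
have B := derive_bracket oI (sf a) (@sX a) (@sY a) Ip.
rewrite !aX in B.
apply: (etrans B).
by apply: f_equal2; [exact: esym (E Y _)|apply: congr1; exact: esym (E X _)].
Qed.

Lemma dirder_add (f g : N -> R^o) p (v : tangent A p) : smooth_map A f -> smooth_map A g ->
  dirder (fun q => f q + g q : R^o) v = dirder f v + dirder g v.
Proof.
move=> sf sg; have pp := atlas_at hA p.
have df := smooth_map_differentiable sf pp; have dg := smooth_map_differentiable sg pp.
apply: (etrans _ (deriveD (diff_derivable df) (diff_derivable dg))).
apply: near_eq_derive; apply: (open_near_eq (@chart_image_open _) (chart_image_mem pp)).
by move=> x; rewrite inE => -[q aq <-]; rewrite fctE !local_repE.
Qed.

End Fields.
End SmoothAtlas.

(** * The slit tangent bundle *)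

Lemma open_nonzero (R : realType) (n : nat) : open [set y : 'rV[R]_n | y != 0].
Proof.
have -> : [set y : 'rV[R]_n | y != 0] = (fun y => `|y|) @^-1` [set t : R | t != 0].
  by apply/funext => y; rewrite /= normr_eq0.
by apply: open_comp; [move=> y _; exact: norm_continuous|exact: open_neq].
Qed.

Section SlitAtlas.
Context {R : realType} {n : nat} (M : manifold R n).
Local Notation slitM := (slit_atlas M).
Implicit Types (a b : chart M) (u : slit M).

Lemma manifold_smooth_atlas : smooth_atlas M.
Proof.
split.
- exact: chart_at_dom.
- by move=> a p q ap aq; apply: coord_inj; rewrite inE.
- move=> a b; apply: coord_open; last by move=> p [].
  by apply: openI; exact: dom_open.
- exact: transition_smooth.
Qed.

Let hM := manifold_smooth_atlas.

Lemma slit_coord_inj a u w : chart_dom a (base_pt u) -> chart_dom a (base_pt w) ->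
  bundle_coord a (vec u) = bundle_coord a (vec w) -> u = w.
Proof.
move=> au aw /eq_row_mx[Ex Ey].
case: u w au aw Ex Ey => p v v0 [q w w0] /= ap aq Ex Ey.
have pq : p = q by exact: (atlas_inj hM ap aq Ex).
case: q / pq w w0 aq Ex Ey => w w0 _ _ Ey.
have vw : v = w by exact: (component_inj hM ap Ey).
by case: w / vw w0 Ey => w0 _; rewrite (bool_irrelevance v0 w0).
Qed.

(** The change of the coordinates (x, y) induced by a change of charts phi of the base:
    (x, y) |-> (phi x, D phi (x) y). *)
Definition slit_transition a b (z : 'rV[R]_(n + n)) : 'rV[R]_(n + n) :=
  row_mx (transition a b (lsubmx z)) ('D_(rsubmx z) (transition a b) (lsubmx z)).

(** The components in a chart identify each tangent space with the space of row vectors, so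
    the coordinates of nonzero vectors fill the base overlap times the nonzero vectors;
    in particular this set is open. *)
Lemma slit_overlapE a b :
  overlap (A := slitM) a b = [set z | overlap (A := M) a b (lsubmx z) /\ rsubmx z != 0].
Proof.
apply/seteqP; split=> [_ [u [au bu] <-]|z [[p [ap bp] Ez] z0]] /=.
  rewrite row_mxKl row_mxKr; split; first by exists (base_pt u).
  apply: contra (vec_neq0 u) => /eqP E; apply/eqP.
  by apply: (component_inj hM au); rewrite E component0.
have v0 : of_component a p (rsubmx z) != 0.
  apply: contra z0 => /eqP E; apply/eqP.
  by rewrite -(component_of_component hM (rsubmx z) ap) E component0.
exists (Slit v0); first by split.
by rewrite /= /bundle_coord /= component_of_component// Ez hsubmxK.
Qed.

Lemma slit_overlap_open a b : open (overlap (A := slitM) a b).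
Proof.
rewrite slit_overlapE; apply: openI.
  apply: open_comp; last exact: (@atlas_open _ _ _ _ hM a b).
  by move=> z _; exact: continuous_lsubmx.
apply: (@open_comp _ _ (rsubmx : 'rV[R]_(n + n) -> 'rV[R]_n) [set y | y != 0]).
  by move=> z _; exact: continuous_rsubmx.
exact: open_nonzero.
Qed.

Lemma slit_transitionE a b :
  {in overlap (A := slitM) a b, transition (A := slitM) a b =1 slit_transition a b}.
Proof.
move=> z; rewrite inE => -[u [au bu] <-].
have E1 : transition (A := slitM) a b (bundle_coord a (vec u)) = bundle_coord b (vec u).
  apply: (@local_rep_coord _ _ _ slitM _ a (fun w => bundle_coord b (vec w)));
    last exact: au.
  by move=> w aw; exact: slit_coord_inj.
have E2 : transition a b (chart_coord a (base_pt u)) = chart_coord b (base_pt u).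
  exact: (local_repE hM _ au).
suff E3 : bundle_coord b (vec u) = slit_transition a b (bundle_coord a (vec u)).
  exact: (etrans E1 E3).
rewrite /slit_transition row_mxKl row_mxKr.
exact: (f_equal2 row_mx (esym E2) (component_change hM (vec u) au bu)).
Qed.

(** The fibre part is sum_i y_i D_i phi (x), a combination of products and composites of
    smooth functions. *)
Lemma slit_transition_smooth a b :
  smooth_on (overlap (A := slitM) a b) (slit_transition a b).
Proof.
have oS := @slit_overlap_open a b; have oW := @atlas_open _ _ _ _ hM a b.
have sW := @atlas_smooth _ _ _ _ hM a b.
have SW z : overlap (A := slitM) a b z -> overlap (A := M) a b (lsubmx z).
  by rewrite slit_overlapE => -[].
have sl := smooth_linear oS (lsubmx : {linear 'rV[R]_(n + n) -> 'rV[R]_n}).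
have sr := smooth_linear oS (rsubmx : {linear 'rV[R]_(n + n) -> 'rV[R]_n}).
apply: (smooth_row_mx oS); apply/(smooth_rowP _ oS) => j.
  exact: (smooth_comp oS oW ((smooth_rowP _ oW).1 sW j) sl SW).
have s : smooth_on (overlap (A := slitM) a b) (fun z => \sum_i rsubmx z 0 i *
    'D_(delta_mx 0 i) (fun x => transition a b x 0 j : R) (lsubmx z)).
  apply: (smooth_sum oS) => i; apply: (smooth_mul oS); first exact: sr.
  exact: (smooth_comp oS oW (smooth_partial i ((smooth_rowP _ oW).1 sW j)) sl SW).
apply: (smooth_ext oS s) => z; rewrite inE => /SW Wz.
have dt : differentiable (transition a b) (lsubmx z) by exact:
  (smooth_row_differentiable oW sW Wz).
rewrite (derive_row_coord _ (diff_derivable dt)).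
exact: esym (derive_basis _ (smooth_differentiable oW ((smooth_rowP _ oW).1 sW j) Wz)).
Qed.

Lemma slit_smooth_atlas : smooth_atlas slitM.
Proof.
split.
- by move=> u; exact: chart_at_dom.
- exact: slit_coord_inj.
- exact: slit_overlap_open.
- move=> a b; apply: (smooth_row_ext (@slit_overlap_open a b)
  (@slit_transition_smooth a b)).
  by move=> z /slit_transitionE ->.
Qed.

Let hS := slit_smooth_atlas.

Lemma derive_slit_transition a b u v : chart_dom a (base_pt u) -> chart_dom b (base_pt u) ->
  'D_v (transition (A := slitM) a b) (bundle_coord a (vec u)) =
  'D_v (slit_transition a b) (bundle_coord a (vec u)).
Proof.
move=> au bu; apply: near_eq_derive.
apply: (open_near_eq (@slit_overlap_open a b) _ (@slit_transitionE a b)).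
by exists u.
Qed.

Lemma lsubmx_component a u (xi : tangent slitM u) : chart_dom a (base_pt u) ->
  lsubmx (component (A := slitM) a xi) = component a (lsubmx xi : tangent M (base_pt u)).
Proof.
move=> au; set c := chart_at M (base_pt u).
have cu : chart_dom c (base_pt u) by exact: chart_at_dom.
have dt : differentiable (transition (A := slitM) c a) (bundle_coord c (vec u)).
  exact: (transition_differentiable hS cu au).
apply: (etrans (esym (derive_linear_comp
  (lsubmx : {linear 'rV[R]_(n + n) -> 'rV[R]_n}) xi dt))).
have E : {in overlap (A := slitM) c a, (fun z => lsubmx (transition (A := slitM) c a z))
    =1 transition c a \o lsubmx}.
  by move=> z Sz; rewrite slit_transitionE// row_mxKl.
apply: (etrans (near_eq_derive _ (open_near_eq (@slit_overlap_open c a) _ E)));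
  first by exists u.
have L (h : R) : lsubmx (h *: (xi : 'rV[R]_(n + n)) + bundle_coord c (vec u)) =
   h *: lsubmx (xi : 'rV[R]_(n + n)) + lsubmx (bundle_coord c (vec u)) by rewrite linearP.
by apply: (etrans (derive_affine_comp _ L)); rewrite row_mxKl.
Qed.

Lemma rhoE u (xi : tangent slitM u) : rho xi = lsubmx (xi : 'rV[R]_(n + n)).
Proof.
have cu : chart_dom (chart_at M (base_pt u)) (base_pt u) by exact: chart_at_dom.
have oI := @chart_image_open _ _ _ _ hS (chart_at M (base_pt u)).
have E : {in chart_image (A := slitM) (chart_at M (base_pt u)),
    local_rep (A := slitM) (chart_at M (base_pt u))
      (fun w => chart_coord (chart_at M (base_pt u)) (base_pt w)) =1 lsubmx}.
  by move=> z; rewrite inE => -[w aw <-]; rewrite (local_repE hS)// row_mxKl.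
apply: (etrans (near_eq_derive _ (open_near_eq oI _ E))); first by exists u.
by apply: derive_along_line => h; rewrite linearP.
Qed.

Lemma component_rho a u (xi : tangent slitM u) : chart_dom a (base_pt u) ->
  component a (rho xi) = lsubmx (component (A := slitM) a xi).
Proof. by move=> au; rewrite rhoE lsubmx_component. Qed.

Lemma gammaE u (v : tangent M (base_pt u)) :
  gamma v = row_mx 0 (v : 'rV[R]_n) :> 'rV[R]_(n + n).
Proof.
rewrite /gamma derive1E; apply: derive_along_line => h.
rewrite /bundle_coord !(component_at hM) scale_row_mx add_row_mx scaler0 add0r addr0.
by rewrite scale0r addr0 [h%:A]mulr1 addrC.
Qed.

(** Along a fibre the induced change of coordinates is linear, so its derivative in a
    vertical direction is the change of components itself. *)
Lemma component_gamma a u (v : tangent M (base_pt u)) : chart_dom a (base_pt u) ->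
  component (A := slitM) a (gamma v) = row_mx 0 (component a v).
Proof.
move=> au; set c := chart_at M (base_pt u).
have cu : chart_dom c (base_pt u) by exact: chart_at_dom.
apply: (etrans (derive_slit_transition _ cu au)); rewrite gammaE.
have dt := transition_differentiable hM cu au.
apply: derive_along_line => h; rewrite /slit_transition.
rewrite !scale_row_mx !add_row_mx !scaler0 !row_mxKl !row_mxKr !add0r; apply: congr1.
exact: derive_linear.
Qed.

Lemma rho_gamma u (v : tangent M (base_pt u)) : rho (gamma v) = 0.
Proof. by rewrite rhoE gammaE row_mxKl. Qed.

Definition pi_rep a (Y : pi_section M) : 'rV[R]_(n + n) -> 'rV[R]_n :=
  local_rep (A := slitM) a (fun u => component a (Y u)).

Lemma pi_repE a (Y : pi_section M) u : chart_dom a (base_pt u) ->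
  pi_rep a Y (bundle_coord a (vec u)) = component a (Y u).
Proof. by move=> au; exact: (local_repE hS). Qed.

Let oI a : open (chart_image (A := slitM) a) := @chart_image_open _ _ _ _ hS a.

Lemma smooth_pi_ext_rep a (Y : pi_section M) (phi : 'rV[R]_(n + n) -> 'rV[R]_n) :
  smooth_on (chart_image (A := slitM) a) phi ->
  (forall u, chart_dom a (base_pt u) -> phi (bundle_coord a (vec u)) = component a (Y u)) ->
  smooth_pi_on a Y.
Proof.
move=> sphi E; apply: (smooth_row_ext (@oI a) sphi) => z; rewrite inE => -[u au <-].
by rewrite (local_repE hS)//; exact: E.
Qed.

Lemma smooth_vf_ext_rep a (X : vector_field slitM)
  (phi : 'rV[R]_(n + n) -> 'rV[R]_(n + n)) :
  smooth_on (chart_image (A := slitM) a) phi ->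
  (forall u, chart_dom a (base_pt u) ->
     phi (bundle_coord a (vec u)) = component (A := slitM) a (X u)) ->
  smooth_vf_on (A := slitM) a X.
Proof.
move=> sphi E; apply: (smooth_row_ext (@oI a) sphi) => z; rewrite inE => -[u au <-].
by rewrite [RHS](local_repE hS)//; exact: E.
Qed.

Lemma smooth_pi_add (Y Z : pi_section M) : smooth_pi Y -> smooth_pi Z ->
  smooth_pi (fun u => Y u + Z u).
Proof.
move=> sY sZ a; apply: (smooth_pi_ext_rep (smooth_row_add (@oI a) (@sY a) (@sZ a))) => u au.
by rewrite [X in X + _]pi_repE// [X in _ + X]pi_repE// (componentD hM).
Qed.

Lemma smooth_pi_opp (Y : pi_section M) : smooth_pi Y -> smooth_pi (fun u => - Y u).
Proof.
move=> sY a; apply: (smooth_pi_ext_rep (smooth_row_opp (@oI a) (@sY a))) => u au.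
by rewrite [X in - X]pi_repE// (componentN hM).
Qed.

Lemma smooth_pi_zero : smooth_pi (fun u => 0 : tangent M (base_pt u)).
Proof.
move=> a; apply: (smooth_pi_ext_rep (smooth_row_cst 0 (@oI a))) => u au.
by rewrite component0.
Qed.

Lemma smooth_eta : smooth_pi (@Defs.eta R n M).
Proof.
move=> a.
have s := smooth_linear (@oI a) (rsubmx : {linear 'rV[R]_(n + n) -> 'rV[R]_n}).
have s' : smooth_on (chart_image (A := slitM) a) (rsubmx : 'rV[R]_(n + n) -> 'rV[R]_n).
  by apply/(smooth_rowP _ (@oI a)).
by apply: (smooth_pi_ext_rep s') => u au; exact: row_mxKr.
Qed.

Lemma smooth_rho (X : vector_field slitM) : smooth_vf X -> smooth_pi (rho_vf X).
Proof.
move=> sX a.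
have s := smooth_row_linear (lsubmx : {linear 'rV[R]_(n + n) -> 'rV[R]_n}) (@oI a) (@sX a).
apply: (smooth_pi_ext_rep s) => u au.
by rewrite component_rho// vf_repE.
Qed.

Lemma smooth_gamma (Y : pi_section M) : smooth_pi Y -> smooth_vf (gamma_vf Y).
Proof.
move=> sY a.
have s := smooth_row_mx (@oI a) (smooth_row_cst (0 : 'rV[R]_n) (@oI a)) (@sY a).
apply: (smooth_vf_ext_rep s) => u au.
by rewrite component_gamma// [X in row_mx _ X]pi_repE.
Qed.

End SlitAtlas.

(** * Linear algebra with smooth coefficients *)

Section Bilinear.
Context {R : realType}.

Lemma linear_sum_scale (V W : lmodType R) (f : V -> W) (I : Type) (r : seq I)
    (c : I -> R) (x : I -> V) :
  linear f -> f (\sum_(i <- r) c i *: x i) = \sum_(i <- r) c i *: f (x i).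
Proof.
move=> lf; elim: r => [|i r IH]; last by rewrite !big_cons lf IH.
by rewrite !big_nil; have := lf (-1) 0 0; rewrite scaleN1r oppr0 addr0 scaleN1r addNr.
Qed.

Lemma row_mx0_basis {k l : nat} (v : 'rV[R]_l) :
  row_mx (0 : 'rV[R]_k) v = \sum_i v 0 i *: row_mx 0 (delta_mx 0 i).
Proof.
have lr : linear (fun w : 'rV[R]_l => row_mx (0 : 'rV[R]_k) w).
  by move=> c x y; rewrite scale_row_mx add_row_mx scaler0 addr0.
by rewrite {1}[v]row_sum_delta; exact: (linear_sum_scale _ _ _ lr).
Qed.

Lemma derive_sum_scale {m : nat} (f : 'rV[R]_m -> R) x (I : Type) (r : seq I)
    (c : I -> R) (v : I -> 'rV[R]_m) : differentiable f x ->
  'D_(\sum_(i <- r) c i *: v i) f x = \sum_(i <- r) c i * 'D_(v i) f x.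
Proof.
move=> df; apply: (@linear_sum_scale _ R^o (fun w => 'D_w f x)) => k u w.
exact: derive_linear.
Qed.

(** Linearity in the inner direction is an identity between functions near x; symmetry of
    second derivatives makes the inner direction the outer one, where linearity at the
    point x is enough. *)
Lemma second_derive_sum {m : nat} (U : set 'rV[R]_m) (f : 'rV[R]_m -> R) x
    (I J : Type) (r : seq I) (s : seq J) (c : I -> R) (d : J -> R)
    (v : I -> 'rV[R]_m) (w : J -> 'rV[R]_m) : open U -> smooth_on U f -> U x ->
  'D_(\sum_(i <- r) c i *: v i) ('D_(\sum_(j <- s) d j *: w j) f) x =
  \sum_(i <- r) \sum_(j <- s) c i * d j * 'D_(v i) ('D_(w j) f) x.
Proof.
move=> oU sf Ux.
have dD t : differentiable ('D_t f) x :=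
  smooth_differentiable oU (smooth_derive oU t sf) Ux.
apply: (etrans (derive_sum_scale _ _ _ (dD _))); apply: eq_bigr => i _.
rewrite -[in RHS](eq_bigr _ (fun j _ => mulrA _ _ _)) -mulr_sumr; congr (_ * _).
apply: (etrans (schwarz _ _ oU sf Ux)).
apply: (etrans (derive_sum_scale _ _ _ (dD _))); apply: eq_bigr => j _.
exact: (congr1 (fun t => d j * t) (schwarz (v i) (w j) oU sf Ux)).
Qed.

Lemma smooth_det {m k : nat} (U : set 'rV[R]_m) (A : 'rV[R]_m -> 'M[R]_k) : open U ->
  (forall i j, smooth_on U (fun x => A x i j : R)) -> smooth_on U (fun x => \det (A x) : R).
Proof.
move=> oU sA; rewrite /determinant.
apply: (smooth_sum oU) => s; apply: (smooth_mul oU); first exact: smooth_cst.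
by apply: (smooth_prod oU) => i; exact: sA.
Qed.

(** Cramer's rule: the entries are cofactors divided by the determinant, both polynomial in
    the entries of the matrix. *)
Lemma smooth_invmx {m k : nat} (U : set 'rV[R]_m) (A : 'rV[R]_m -> 'M[R]_k) : open U ->
  (forall i j, smooth_on U (fun x => A x i j : R)) ->
  (forall x, U x -> A x \in unitmx) ->
  forall i j, smooth_on U (fun x => invmx (A x) i j : R).
Proof.
move=> oU sA uA i j.
have sadj : smooth_on U (fun x => cofactor (A x) j i : R).
  rewrite /cofactor; apply: (smooth_mul oU); first exact: smooth_cst.
  apply: (smooth_det oU) => a b.
  by apply: (smooth_ext oU (sA (lift j a) (lift i b))) => x _; rewrite !mxE.
have sdet := smooth_inv oU (f := fun x => \det (A x)) _ (smooth_det oU sA).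
have s := smooth_mul oU (sdet _) sadj.
apply: (smooth_ext oU (s _)) => x; last first.
  by rewrite inE => Ux; rewrite /invmx uA// !mxE.
by move=> /uA; rewrite unitmxE unitfE.
Qed.

Lemma smooth_mulmx {m k l : nat} (U : set 'rV[R]_m) (phi : 'rV[R]_m -> 'rV[R]_k)
    (A : 'rV[R]_m -> 'M[R]_(k, l)) : open U -> smooth_on U phi ->
  (forall i j, smooth_on U (fun x => A x i j : R)) ->
  smooth_on U (fun x => phi x *m A x).
Proof.
move=> oU sphi sA; apply/(smooth_rowP _ oU) => j.
have s : smooth_on U (fun x => \sum_i phi x 0 i * A x i j).
  apply: (smooth_sum oU) => i; apply: (smooth_mul oU) (sA i j).
  exact: ((smooth_rowP _ oU).1 sphi i).
by apply: (smooth_ext oU s) => x _; rewrite mxE.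
Qed.

End Bilinear.

(** * The Finsler metric *)

Section Metric.
Context {R : realType} {n : nat} (M : manifold R n).
Variable L : forall p : M, tangent M p -> R.
Hypothesis hL : finsler L.
Local Notation slitM := (slit_atlas M).
Implicit Types (a b : chart M) (u : slit M).
Let hM := manifold_smooth_atlas M.
Let hS := slit_smooth_atlas M.
Let oI a : open (chart_image (A := slitM) a) := @chart_image_open _ _ _ _ hS a.

Definition energy_rep a : 'rV[R]_(n + n) -> R :=
  local_rep (A := slitM) a (fun u => L (vec u) ^+ 2 : R^o).

Lemma smooth_energy_rep a : smooth_on (chart_image (A := slitM) a) (energy_rep a).
Proof.
have sL := @finsler_smooth _ _ _ _ hL a.
apply: (smooth_ext (@oI a) (smooth_mul (@oI a) sL sL)) => z; rewrite inE => -[u au <-].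
by rewrite /energy_rep !(local_repE hS).
Qed.

(** Derivatives are taken along the fibre coordinates y only, in an arbitrary chart a, while
    the metric is defined with the preferred chart at each point. *)
Definition fiber_hessian a (z : 'rV[R]_(n + n)) (v w : 'rV[R]_n) : R :=
  'D_(row_mx 0 v) ('D_(row_mx 0 w) (energy_rep a)) z.

(** On one fibre the passage from the preferred chart to a is linear in y, so second fibre
    derivatives of L^2 in the two charts correspond under the components of vectors. This
    makes the metric accessible in a fixed chart, where its smoothness and its derivatives
    can be computed. *)
Lemma metric_hessian a u (v w : tangent M (base_pt u)) : chart_dom a (base_pt u) ->
  metric L v w =
    2^-1 * fiber_hessian a (bundle_coord a (vec u)) (component a v) (component a w).
Proof.
move=> au; set p := base_pt u.
pose E (i : 'I_n) := row_mx (0 : 'rV[R]_n) (component a (delta_mx 0 i : tangent M p)).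
pose l (y : 'rV[R]_n) := row_mx (chart_coord a p) (component a (y : tangent M p)).
have lE (i : 'I_n) y (h : R) : l (h *: delta_mx 0 i + y) = h *: E i + l y.
  rewrite /l /E scale_row_mx add_row_mx scaler0 add0r; apply: congr1.
  exact: (componentP hM h (delta_mx 0 i : tangent M p) y au).
pose V := [set y : 'rV[R]_n | y != 0].
have oV : open V by exact: open_nonzero.
have Vu : V (vec u) by exact: vec_neq0.
have E0 : {in V, (fun y => (L (y : tangent M p) ^+ 2 : R^o)) =1 energy_rep a \o l}.
  move=> y; rewrite inE => y0.
  exact: (esym (@local_repE _ _ _ slitM hS _ a (fun u => L (vec u) ^+ 2 : R^o)
    (@Slit _ _ M p y y0) au)).
have E1 i : {in V, 'D_(delta_mx 0 i) (fun y => (L (y : tangent M p) ^+ 2 : R^o)) =1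
    'D_(E i) (energy_rep a) \o l}.
  move=> y; rewrite inE => y0.
  apply: (etrans (near_eq_derive _ (open_near_eq oV y0 E0))).
  exact: (derive_affine_comp _ (lE i y)).
have E2 i j : metric_coef L u i j =
    2^-1 * 'D_(E i) ('D_(E j) (energy_rep a)) (bundle_coord a (vec u)).
  have e1 := near_eq_derive (delta_mx 0 i) (open_near_eq oV Vu (E1 j)).
  have e2 := derive_affine_comp ('D_(E j) (energy_rep a)) (lE i (vec u)).
  exact: (congr1 (fun t => 2^-1 * t) (etrans e1 e2)).
have cE (x : tangent M p) : row_mx 0 (component a x) = \sum_i (x : 'rV[R]_n) 0 i *: E i.
  have lr : linear (fun w : tangent M p => row_mx (0 : 'rV[R]_n) (component a w)).
    by move=> c y y'; rewrite (componentP hM)// scale_row_mx add_row_mx scaler0 addr0.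
  rewrite {1}[x]row_sum_delta.
  exact: (linear_sum_scale _ _ _ lr).
have az : chart_image (A := slitM) a (bundle_coord a (vec u)) by exists u.
rewrite /fiber_hessian (cE v) (cE w).
have e := second_derive_sum _ _ _ _ _ _ (@oI a) (@smooth_energy_rep a) az.
apply: (etrans _ (esym (congr1 (fun t => 2^-1 * t) (e _ _ _ _ _ _ _ _)))).
rewrite /metric mulr_sumr; apply: eq_bigr => i _; rewrite mulr_sumr; apply: eq_bigr => j _.
rewrite E2; ring.
Qed.

Lemma fiber_hessian_sym a z v w : chart_image (A := slitM) a z ->
  fiber_hessian a z v w = fiber_hessian a z w v.
Proof. move=> az; exact: (schwarz _ _ (@oI a) (@smooth_energy_rep a) az). Qed.

Lemma metricC u (v w : tangent M (base_pt u)) : metric L v w = metric L w v.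
Proof.
have cu : chart_dom (chart_at M (base_pt u)) (base_pt u) by exact: chart_at_dom.
have cz : chart_image (A := slitM) (chart_at M (base_pt u))
  (bundle_coord (chart_at M (base_pt u)) (vec u)) by exists u.
apply: (etrans (metric_hessian v w cu)); apply: (etrans _ (esym (metric_hessian w v cu))).
by apply: congr1; exact: fiber_hessian_sym cz.
Qed.

Lemma metricDl u (v v' w : tangent M (base_pt u)) :
  metric L (v + v') w = metric L v w + metric L v' w.
Proof.
rewrite /metric -big_split; apply: eq_bigr => i _; rewrite -big_split;
  apply: eq_bigr => j _ /=.
by rewrite mxE; ring.
Qed.

Lemma metricNl u (v w : tangent M (base_pt u)) : metric L (- v) w = - metric L v w.
Proof.
rewrite /metric -sumrN; apply: eq_bigr => i _; rewrite -sumrN; apply: eq_bigr => j _ /=.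
by rewrite mxE; ring.
Qed.

Lemma metricDr u (v w w' : tangent M (base_pt u)) :
  metric L v (w + w') = metric L v w + metric L v w'.
Proof. by rewrite metricC metricDl ![metric L _ v]metricC. Qed.

Lemma metric0l u (w : tangent M (base_pt u)) : metric L 0 w = 0.
Proof. by have /eqP := metricNl 0 w; rewrite oppr0 -addr_eq0 -mulr2n mulrn_eq0 => /=
  /eqP. Qed.

Definition hessian_coef a (i j : 'I_n) : 'rV[R]_(n + n) -> R :=
  fun z => fiber_hessian a z (delta_mx 0 i) (delta_mx 0 j).

Lemma smooth_hessian_coef a i j :
  smooth_on (chart_image (A := slitM) a) (hessian_coef a i j).
Proof. by apply: (smooth_derive (@oI a)); apply: (smooth_derive (@oI a));
  exact: smooth_energy_rep. Qed.

Lemma fiber_hessian_coef a z v w : chart_image (A := slitM) a z ->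
  fiber_hessian a z v w = \sum_i \sum_j v 0 i * w 0 j * hessian_coef a i j z.
Proof.
move=> az.
rewrite /fiber_hessian (row_mx0_basis v) (row_mx0_basis w).
exact: (second_derive_sum _ _ _ _ _ _ (@oI a) (@smooth_energy_rep a) az).
Qed.

Definition metric_rep a (Y Z : pi_section M) (z : 'rV[R]_(n + n)) : R :=
  2^-1 * \sum_i \sum_j pi_rep a Y z 0 i * pi_rep a Z z 0 j * hessian_coef a i j z.

Lemma metric_repE a (Y Z : pi_section M) :
  {in chart_image (A := slitM) a,
    local_rep (A := slitM) a (fun u => metric L (Y u) (Z u) : R^o) =1 metric_rep a Y Z}.
Proof.
move=> z; rewrite inE => -[u au <-]; rewrite (local_repE hS)//.
rewrite (metric_hessian _ _ au) fiber_hessian_coef; last by exists u.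
by rewrite /metric_rep !(pi_repE _ au).
Qed.

Lemma smooth_metric (Y Z : pi_section M) : smooth_pi Y -> smooth_pi Z ->
  smooth_map slitM (fun u => metric L (Y u) (Z u) : R^o).
Proof.
move=> sY sZ a.
have sYi i := (smooth_rowP _ (@oI a)).1 (@sY a) i.
have sZi i := (smooth_rowP _ (@oI a)).1 (@sZ a) i.
have s : smooth_on (chart_image (A := slitM) a) (metric_rep a Y Z).
  apply: (smooth_mul (@oI a)); first exact: smooth_cst.
  apply: (smooth_sum (@oI a)) => i; apply: (smooth_sum (@oI a)) => j.
  apply: (smooth_mul (@oI a)); last exact: smooth_hessian_coef.
  exact: (smooth_mul (@oI a) (sYi i) (sZi j)).
by apply: (smooth_ext (@oI a) s) => z /metric_repE ->.
Qed.

End Metric.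

(** * The horizontal map of a regular connection *)

Lemma sum_scale_split {R : realType} {k l m : nat} (c : 'rV[R]_(k + l))
  (f : 'I_(k + l) -> 'rV[R]_m) :
  \sum_i c 0 i *: f i = lsubmx c *m (\matrix_(i, j) f (lshift l i) 0 j)
    + rsubmx c *m (\matrix_(i, j) f (rshift k i) 0 j).
Proof.
rewrite big_split_ord; apply/rowP => j; rewrite !mxE !summxE.
by congr (_ + _); apply: eq_bigr => i _; rewrite !mxE.
Qed.

Section Connection.
Context {R : realType} {n : nat} (M : manifold R n).
Variable D : pi_derivation M.
Hypotheses (lD : linear_connection D) (rD : regular D).
Local Notation slitM := (slit_atlas M).
Implicit Types (a b : chart M) (u : slit M).
Let hM := manifold_smooth_atlas M.
Let hS := slit_smooth_atlas M.
Let oI a : open (chart_image (A := slitM) a) := @chart_image_open _ _ _ _ hS a.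

Lemma connection_map_linear u :
  linear (fun xi : tangent slitM u => connection_map D xi).
Proof. by move=> c x y; exact: (connection_linear lD (@smooth_eta _ _ M)). Qed.

Lemma rho_linear u : linear (fun xi : tangent slitM u => rho xi).
Proof. by move=> c x y; rewrite !rhoE linearP. Qed.

(** The horizontal component of any lift of v, for the splitting given by regularity, is
    horizontal and still lies over v. *)
Lemma betaP u (v : tangent M (base_pt u)) :
  connection_map D (beta D v) = 0 /\ rho (beta D v) = v.
Proof.
apply: (@xgetPex _ 0 [set xi : tangent slitM u | connection_map D xi = 0 /\ rho xi = v]).
have [dec _] := rD u.
have [x1 [x2 [V1 K2 E]]] := dec (row_mx (v : 'rV[R]_n) (0 : 'rV[R]_n)).
exists x2; split=> //.
have := rho_linear 1 x1 x2; rewrite /= !scale1r V1 add0r -E => <-.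
by rewrite rhoE row_mxKl.
Qed.

Lemma rho_beta u (v : tangent M (base_pt u)) : rho (beta D v) = v.
Proof. by have [] := betaP v. Qed.

(** The coordinate fields of the chart a. They are smooth over the domain of that chart,
    and the connection is applied to them there. *)
Definition frame a (k : 'I_(n + n)) : vector_field slitM :=
  fun u => of_component (A := slitM) a u (delta_mx 0 k).

Lemma smooth_frame a k : smooth_vf_on (A := slitM) a (frame a k).
Proof.
apply: (smooth_vf_ext_rep (smooth_row_cst (delta_mx 0 k : 'rV[R]_(n + n)) (@oI a))) => u au.
by rewrite (component_of_component hS).
Qed.

(** The connection map on the coordinate fields; these are the coefficients of the linear
    system that defines the horizontal map. *)
Definition frame_map a (k : 'I_(n + n)) : 'rV[R]_(n + n) -> 'rV[R]_n :=
  pi_rep a (covd D (frame a k) (@Defs.eta R n M)).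

Definition horizontal_matrix a z : 'M[R]_n := \matrix_(i, j) frame_map a (lshift n i) z 0 j.
Definition vertical_matrix a z : 'M[R]_n := \matrix_(i, j) frame_map a (rshift n i) z 0 j.

Lemma smooth_frame_map a k : smooth_on (chart_image (A := slitM) a) (frame_map a k).
Proof. exact: (@connection_smooth _ _ _ _ lD a _ _ (@smooth_frame a k)
  (@smooth_eta _ _ M)). Qed.

Lemma component_connection_map a u (xi : tangent slitM u) : chart_dom a (base_pt u) ->
  component a (connection_map D xi) =
    lsubmx (component (A := slitM) a xi) *m horizontal_matrix a (bundle_coord a (vec u))
    + rsubmx (component (A := slitM) a xi) *m vertical_matrix a (bundle_coord a (vec u)).
Proof.
move=> au; have [c Ec] : exists c, component (A := slitM) a xi = c by eexists.
have E : xi = \sum_k c 0 k *: frame a k u.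
  apply: (component_inj hS (au : chart_dom (a : chart slitM) u)); rewrite Ec.
  have lc : linear (fun x : tangent slitM u => component (A := slitM) a x).
    by move=> k x y; exact: (componentP hS).
  apply: (etrans _ (esym (linear_sum_scale _ _ _ lc))).
  rewrite [LHS]row_sum_delta; apply: eq_bigr => k _.
  by rewrite (component_of_component hS).
have lK : linear (fun x : tangent slitM u => component a (connection_map D x)).
  by move=> k x y; rewrite connection_map_linear (componentP hM).
have Ek k : component a (connection_map D (frame a k u)) =
  frame_map a k (bundle_coord a (vec u)).
  exact: esym (pi_repE _ au).
have F : component a (connection_map D xi) =
    \sum_k c 0 k *: frame_map a k (bundle_coord a (vec u)).
  apply: (etrans (congr1 (fun x => component a (connection_map D x)) E)).
  apply: (etrans (linear_sum_scale _ _ _ lK)).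
  by apply: eq_bigr => k _; apply: congr1; exact: Ek.
by apply: (etrans F); rewrite Ec; exact: sum_scale_split.
Qed.

(** A vector in the kernel would be the components of a vertical vector killed by the
    connection map, and regularity leaves only 0. *)
Lemma vertical_matrix_unit a z : chart_image (A := slitM) a z ->
  vertical_matrix a z \in unitmx.
Proof.
move=> [u au <-]; rewrite -row_free_unit; apply: inj_row_free => y y0.
pose xi := of_component (A := slitM) a u (row_mx 0 y).
have cxi : component (A := slitM) a xi = row_mx 0 y by exact: (component_of_component hS).
have Vxi : vertical xi.
  by apply: (component_inj hM au); rewrite component_rho// cxi row_mxKl component0.
have Kxi : connection_map D xi = 0.
  apply: (component_inj hM au); rewrite component_connection_map// cxi row_mxKl row_mxKr.
  by rewrite mul0mx add0r component0; exact: y0.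
have [_ inj] := rD u.
by rewrite -[y](row_mxKr (0 : 'rV[R]_n)) -cxi (inj _ Vxi Kxi) component0 linear0.
Qed.

(** A lift row_mx v b is horizontal when v *m horizontal_matrix + b *m vertical_matrix = 0,
    which is solved for b. *)
Lemma component_beta a u (v : tangent M (base_pt u)) : chart_dom a (base_pt u) ->
  component (A := slitM) a (beta D v) = row_mx (component a v)
    (- (component a v *m horizontal_matrix a (bundle_coord a (vec u)))
      *m invmx (vertical_matrix a (bundle_coord a (vec u)))).
Proof.
move=> au; have [Kb rb] := betaP v.
have El : lsubmx (component (A := slitM) a (beta D v)) = component a v.
  by rewrite -(component_rho _ au) rb.
rewrite -[LHS]hsubmxK El; apply: congr1.
have := component_connection_map (beta D v) au; rewrite Kb component0 El => /esym/eqP.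
rewrite addrC addr_eq0 => /eqP <-; rewrite mulmxK//.
by apply: vertical_matrix_unit; exists u.
Qed.

Lemma smooth_beta (Y : pi_section M) : smooth_pi Y -> smooth_vf (beta_vf D Y).
Proof.
move=> sY a.
have sk k j := (smooth_rowP _ (@oI a)).1 (@smooth_frame_map a k) j.
have sH i j : smooth_on (chart_image (A := slitM) a)
  (fun z => horizontal_matrix a z i j : R).
  by apply: (smooth_ext (@oI a) (sk (lshift n i) j)) => z _; rewrite mxE.
have sV i j : smooth_on (chart_image (A := slitM) a) (fun z => vertical_matrix a z i j : R).
  by apply: (smooth_ext (@oI a) (sk (rshift n i) j)) => z _; rewrite mxE.
have sVi := smooth_invmx (@oI a) sV (@vertical_matrix_unit a).
have s1 := smooth_row_opp (@oI a) (smooth_mulmx (@oI a) (@sY a) sH).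
have s := smooth_row_mx (@oI a) (@sY a) (smooth_mulmx (@oI a) s1 sVi).
apply: (smooth_vf_ext_rep s) => u au.
by rewrite component_beta// [local_rep _ _ _](pi_repE _ au).
Qed.

Lemma smooth_covd (X : vector_field slitM) (Y : pi_section M) :
  smooth_vf X -> smooth_pi Y -> smooth_pi (covd D X Y).
Proof. by move=> sX sY a; exact: (@connection_smooth _ _ _ _ lD a _ _ (@sX a) sY). Qed.

Lemma connection0 u (xi : tangent slitM u) : D xi (fun w => 0 : tangent M (base_pt w)) = 0.
Proof.
have s0 := @smooth_pi_zero _ _ M.
have /eqP := connection_additive lD xi s0 s0.
have -> : (fun w : slit M => (0 : tangent M (base_pt w)) + 0) = (fun w => 0).
  by apply: functional_extensionality_dep => w; rewrite addr0.
by rewrite -subr_eq0 opprD addrA subrr sub0r oppr_eq0 => /eqP.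
Qed.

Lemma connection_opp u (xi : tangent slitM u) (Y : pi_section M) : smooth_pi Y ->
  D xi (fun w => - Y w) = - D xi Y.
Proof.
move=> sY; apply/eqP; rewrite -addr_eq0 addrC.
rewrite -(connection_additive lD xi sY (smooth_pi_opp sY)) -(connection0 xi); apply/eqP.
by congr (D xi _); apply: functional_extensionality_dep => w; rewrite subrr.
Qed.

Lemma vertical_gamma u (xi : tangent slitM u) : vertical xi ->
  xi = gamma (rsubmx (xi : 'rV[R]_(n + n)) : tangent M (base_pt u)).
Proof. by rewrite /vertical rhoE gammaE => V0; rewrite -[LHS]hsubmxK V0. Qed.

(** A section W with X = beta (rho X) + gamma W. Hypotheses on global sections can be applied
    to the direction X u through it, since it is smooth when X is. *)
Definition vertical_part (X : vector_field slitM) : pi_section M :=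
  fun u => rsubmx (X u - beta D (rho (X u)) : 'rV[R]_(n + n)).

Lemma horizontal_vertical (X : vector_field slitM) u :
  X u = beta D (rho (X u)) + gamma (vertical_part X u).
Proof.
pose b : tangent slitM u := beta D (rho (X u)).
have V : vertical (X u - b).
  have E := rho_linear (-1) b (X u).
  rewrite /vertical -[X u - b]addrC -scaleN1r; apply: (etrans E).
  by rewrite (rho_beta (rho (X u))) scaleN1r addNr.
apply: (etrans _ (congr1 (fun t => b + t) (vertical_gamma V))).
by rewrite addrCA subrr addr0.
Qed.

Lemma smooth_vertical_part (X : vector_field slitM) : smooth_vf X ->
  smooth_pi (vertical_part X).
Proof.
move=> sX a; have sB := smooth_beta (smooth_rho sX).
have s := smooth_row_linear (rsubmx : {linear 'rV[R]_(n + n) -> 'rV[R]_n}) (@oI a)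
  (smooth_row_add (@oI a) (@sX a) (smooth_row_opp (@oI a) (@sB a))).
apply: (smooth_pi_ext_rep s) => u au.
rewrite [X in X - _](local_repE hS)// [X in _ - X](local_repE hS)//.
rewrite -(componentN hS)// -(componentD hS)//.
have E : X u - beta_vf D (rho_vf X) u = gamma (vertical_part X u).
  by apply/eqP; rewrite subr_eq addrC; apply/eqP; exact: horizontal_vertical.
by rewrite E (component_gamma _ au); exact: row_mxKr.
Qed.

Lemma connection_decomp (X : vector_field slitM) (Y : pi_section M) u : smooth_pi Y ->
  covd D X Y u = covd D (beta_vf D (rho_vf X)) Y u + covd D
    (gamma_vf (vertical_part X)) Y u.
Proof.
move=> sY; rewrite /covd {1}[X u]horizontal_vertical.
have := connection_linear lD sY 1 (beta D (rho (X u))) (gamma (vertical_part X u)).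
by rewrite !scale1r.
Qed.

End Connection.

(** * Torsion and curvature of a regular connection *)

Lemma product_rule_arith {R : comPzRingType} (a b c a' b' c' : R) :
  (a * b) * c' + c * (a * b' + b * a') = a' * b * c + a * b' * c + a * b * c'.
Proof. ring. Qed.

Lemma derive_form_sum {R : realType} {m n : nat} (U : set 'rV[R]_m) (c : R)
    (p q : 'rV[R]_m -> 'rV[R]_n) (h : 'I_n -> 'I_n -> 'rV[R]_m -> R) z v :
  open U -> smooth_on U p -> smooth_on U q -> (forall i j, smooth_on U (h i j)) -> U z ->
  'D_v (fun x => c * \sum_i \sum_j p x 0 i * q x 0 j * h i j x : R) z =
  c * \sum_i \sum_j ('D_v p z 0 i * q z 0 j * h i j z + p z 0 i * 'D_v q z 0 j * h i j z
     + p z 0 i * q z 0 j * 'D_v (h i j) z).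
Proof.
move=> oU sp sq sh Uz.
have dr (f : 'rV[R]_m -> R) : smooth_on U f -> derivable f z v.
  by move=> sf; apply: diff_derivable; exact: (smooth_differentiable oU sf Uz).
pose pi i : 'rV[R]_m -> R := fun x => p x 0 i.
pose qj j : 'rV[R]_m -> R := fun x => q x 0 j.
have dp i : derivable (pi i) z v := dr _ ((smooth_rowP _ oU).1 sp i).
have dq j : derivable (qj j) z v := dr _ ((smooth_rowP _ oU).1 sq j).
have dh i j := dr _ (sh i j).
have dpq i j : derivable (pi i * qj j) z v by exact: derivableM.
have dpqh i j : derivable (pi i * qj j * h i j) z v by exact: derivableM.
have E : (fun x => c * \sum_i \sum_j p x 0 i * q x 0 j * h i j x : R) =
    c *: \sum_i \sum_j (pi i * qj j * h i j).
  apply/funext => x; rewrite fctE fct_sumE; congr (_ * _); apply: eq_bigr => i _.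
  by rewrite fct_sumE.
have ds i : derivable (\sum_j (pi i * qj j * h i j)) z v by exact: (derivable_sum (dpqh i)).
have ds2 : derivable (\sum_i \sum_j (pi i * qj j * h i j)) z v by exact: (derivable_sum ds).
apply: (etrans (congr1 (fun f => 'D_v f z) E)); apply: (etrans (deriveZ _ ds2)).
congr (_ * _); apply: (etrans (derive_sum ds)); apply: eq_bigr => i _.
apply: (etrans (derive_sum (dpqh i))); apply: eq_bigr => j _.
apply: (etrans (deriveM (dpq i j) (dh i j))).
have cp : 'D_v p z 0 i = 'D_v (pi i) z.
  exact: (derive_row_coord _ (diff_derivable (smooth_row_differentiable oU sp Uz))).
have cq : 'D_v q z 0 j = 'D_v (qj j) z.
  exact: (derive_row_coord _ (diff_derivable (smooth_row_differentiable oU sq Uz))).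
rewrite (deriveM (dp i) (dq j)) cp cq.
exact: product_rule_arith.
Qed.

Lemma skew_arith {R : realFieldType} (a1 a2 a3 a4 b1 b4 c d : R) :
  c + d = (a1 + a2 + (a3 + a4)) - (b1 + a3 + (a2 + b4)) ->
  - a1 + b1 + c = - (- a4 + b4 + d).
Proof. by move=> h; lra. Qed.

Section Brackets.
Context {R : realType} {n : nat} (M : manifold R n).
Variable D : pi_derivation M.
Hypotheses (lD : linear_connection D) (rD : regular D).
Local Notation slitM := (slit_atlas M).
Let hM := manifold_smooth_atlas M.
Let hS := slit_smooth_atlas M.
Let oI (a : chart M) : open (chart_image (A := slitM) a) := @chart_image_open _ _ _ _ hS a.
Implicit Types (u : slit M) (V W : vector_field slitM) (X Y Z : pi_section M).

(** The base part of a bracket only involves the base parts of the fields that are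
    differentiated. These parts are parameters, with equations, because for lifts they are
    the lifted section or 0. *)
Lemma component_rho_lie (a : chart M) V W Y Z u : smooth_vf V -> smooth_vf W ->
  rho_vf V = Y -> rho_vf W = Z -> chart_dom a (base_pt u) ->
  component a (rho (lie_bracket V W u)) =
    'D_(component (A := slitM) a (V u)) (pi_rep a Z) (bundle_coord a (vec u))
    - 'D_(component (A := slitM) a (W u)) (pi_rep a Y) (bundle_coord a (vec u)).
Proof.
move=> sV sW <- <- au.
have Iu : chart_image (A := slitM) a (bundle_coord a (vec u)) by exists u.
have E W' v : smooth_vf W' ->
    lsubmx ('D_v (vf_rep (A := slitM) a W') (bundle_coord a (vec u))) =
    'D_v (pi_rep a (rho_vf W')) (bundle_coord a (vec u)).
  move=> sW'.
  have d := smooth_row_differentiable (@oI a) (@sW' a) Iu.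
  apply: (etrans (esym (derive_linear_comp
    (lsubmx : {linear 'rV[R]_(n + n) -> 'rV[R]_n}) v d))).
  apply: near_eq_derive; apply: (open_near_eq (@oI a) Iu) => z; rewrite inE => -[w aw <-].
  apply: (etrans (congr1 lsubmx (vf_repE hS W' (aw : chart_dom (a : chart slitM) w)))).
  apply: (etrans (esym (component_rho (W' w) aw))).
  exact: esym (pi_repE (rho_vf W') aw).
rewrite (component_rho _ au) (lie_bracket_component hS sV sW
  (au : chart_dom (a : chart slitM) u)).
by rewrite linearB; exact: (f_equal2 (fun x y => x - y) (E _ _ sW) (E _ _ sV)).
Qed.

Lemma derive_pi_rep0 (a : chart M) u v : chart_dom a (base_pt u) ->
  'D_v (pi_rep a (fun w => 0 : tangent M (base_pt w))) (bundle_coord a (vec u)) = 0.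
Proof.
move=> au; have Iu : chart_image (A := slitM) a (bundle_coord a (vec u)) by exists u.
have E : {in chart_image (A := slitM) a,
    pi_rep a (fun w => 0 : tangent M (base_pt w)) =1 cst 0}.
  by move=> z; rewrite inE => -[w aw <-]; rewrite (pi_repE _ aw) component0.
by apply: (etrans (near_eq_derive v (open_near_eq (@oI a) Iu E))); exact: derive_cst.
Qed.

Lemma rho_vf_gamma X : rho_vf (gamma_vf X) = fun u => 0.
Proof. by apply: functional_extensionality_dep => u; exact: rho_gamma. Qed.

Lemma rho_vf_beta X : rho_vf (beta_vf D X) = X.
Proof. by apply: functional_extensionality_dep => u; exact: rho_beta. Qed.

Lemma rho_lie_gamma X Y u : smooth_pi X -> smooth_pi Y ->
  rho (lie_bracket (gamma_vf X) (gamma_vf Y) u) = 0.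
Proof.
move=> sX sY; have cu : chart_dom (chart_at M (base_pt u)) (base_pt u) by exact:
  chart_at_dom.
apply: (component_inj hM cu); apply: (etrans _ (esym (component0 _ _))).
apply: (etrans (component_rho_lie (smooth_gamma sX) (smooth_gamma sY)
  (rho_vf_gamma X) (rho_vf_gamma Y) cu)).
exact: (etrans (f_equal2 (fun x y => x - y) (derive_pi_rep0 _ cu) (derive_pi_rep0 _ cu))
  (subrr 0)).
Qed.

Lemma component_rho_lie_gamma_beta (a : chart M) X Y u : smooth_pi X -> smooth_pi Y ->
  chart_dom a (base_pt u) ->
  component a (rho (lie_bracket (gamma_vf X) (beta_vf D Y) u)) =
    'D_(row_mx 0 (component a (X u))) (pi_rep a Y) (bundle_coord a (vec u)).
Proof.
move=> sX sY au.
apply: (etrans (component_rho_lie (smooth_gamma sX) (smooth_beta lD rD sY)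
  (rho_vf_gamma X) (rho_vf_beta Y) au)).
apply: (etrans (congr1 (fun x => _ - x) (derive_pi_rep0 _ au))); rewrite subr0.
exact: (congr1 (fun v => 'D_v (pi_rep a Y) (bundle_coord a (vec u)))
  (component_gamma (X u) au)).
Qed.

Lemma rho_opp u (xi : tangent slitM u) : rho (- xi) = - rho xi.
Proof.
apply: (etrans (rhoE (- xi))); apply: (etrans (linearN lsubmx (xi : 'rV[R]_(n + n)))).
exact: (congr1 -%R (esym (rhoE xi))).
Qed.

Lemma rho_lie_antisym V W u : rho_vf (lie_bracket W V) u = - rho_vf (lie_bracket V W) u.
Proof.
apply: (etrans _ (rho_opp (lie_bracket V W u))).
exact: (congr1 (fun xi : tangent slitM u => rho xi) (esym (opprB _ _))).
Qed.

Lemma torsion_antisym V W u : torsion D V W u = - torsion D W V u.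
Proof.
have swap (a b c c' : tangent M (base_pt u)) : c' = - c -> a - b - c = - (b - a - c').
  by move=> ->; rewrite opprK opprD opprB.
exact: (swap _ _ _ _ (rho_lie_antisym V W u)).
Qed.

Lemma T_torsionE X Y u : T_torsion D X Y u =
  covd D (gamma_vf X) Y u - rho (lie_bracket (gamma_vf X) (beta_vf D Y) u).
Proof.
by rewrite /T_torsion /torsion rho_vf_beta rho_vf_gamma [X in _ - X - _](connection0 lD)
  subr0.
Qed.

Lemma smooth_T_torsion X Y : smooth_pi X -> smooth_pi Y -> smooth_pi (T_torsion D X Y).
Proof.
move=> sX sY.
have -> : T_torsion D X Y = fun u => covd D (gamma_vf X) Y u
    + - rho_vf (lie_bracket (gamma_vf X) (beta_vf D Y)) u.
  by apply: functional_extensionality_dep => u; exact: T_torsionE.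
apply: smooth_pi_add; first exact: (smooth_covd lD (smooth_gamma sX) sY).
apply: smooth_pi_opp; apply: smooth_rho.
exact: (smooth_lie_bracket hS (smooth_gamma sX) (smooth_beta lD rD sY)).
Qed.

Lemma torsion_rho V W Y Z u : rho_vf V = Y -> rho_vf W = Z ->
  torsion D V W u = covd D V Z u - covd D W Y u - rho_vf (lie_bracket V W) u.
Proof. by move=> <- <-. Qed.

Lemma torsion_gamma_gamma X Y u : smooth_pi X -> smooth_pi Y ->
  torsion D (gamma_vf X) (gamma_vf Y) u = 0.
Proof.
move=> sX sY; apply: (etrans (torsion_rho u (rho_vf_gamma X) (rho_vf_gamma Y))).
have z (a b c : tangent M (base_pt u)) : a = 0 -> b = 0 -> c = 0 -> a - b - c = 0.
  by move=> -> -> ->; rewrite !subr0.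
by apply: z; [exact: (connection0 lD)|exact: (connection0 lD)|exact: rho_lie_gamma].
Qed.

Lemma curvature0 V W u : curvature D V W (fun w => 0) u = 0.
Proof.
have c0 V' : covd D V' (fun w => 0 : tangent M (base_pt w)) = fun w => 0.
  by apply: functional_extensionality_dep => w; exact: (connection0 lD).
have z (a b c : tangent M (base_pt u)) : a = 0 -> b = 0 -> c = 0 -> - a + b + c = 0.
  by move=> -> -> ->; rewrite oppr0 !addr0.
apply: z; last exact: (connection0 lD).
  exact: (etrans (congr1 (fun s => covd D V s u) (c0 W)) (connection0 lD _)).
exact: (etrans (congr1 (fun s => covd D W s u) (c0 V)) (connection0 lD _)).
Qed.

Lemma curvature_opp V W Z u : smooth_vf V -> smooth_vf W -> smooth_pi Z ->
  curvature D V W (fun w => - Z w) u = - curvature D V W Z u.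
Proof.
move=> sV sW sZ.
have cN V' Z' : smooth_pi Z' -> covd D V' (fun w => - Z' w) = fun w => - covd D V' Z' w.
  by move=> sZ'; apply: functional_extensionality_dep => w; exact: (connection_opp lD).
have z (a a' b b' c c' : tangent M (base_pt u)) :
    a' = - a -> b' = - b -> c' = - c -> - a' + b' + c' = - (- a + b + c).
  by move=> -> -> ->; rewrite !opprD.
apply: z; last exact: (connection_opp lD _ sZ).
  apply: (etrans (congr1 (fun s => covd D V s u) (cN W Z sZ))).
  exact: (connection_opp lD _ (smooth_covd lD sW sZ)).
apply: (etrans (congr1 (fun s => covd D W s u) (cN V Z sZ))).
exact: (connection_opp lD _ (smooth_covd lD sV sZ)).
Qed.

(** The function g(Y, Z) is differentiated twice along V and W. The mixed terms are
    symmetric in V and W, so antisymmetrising and subtracting the derivative along the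
    bracket leaves the two curvature terms, while the left side vanishes. *)
Lemma curvature_metric_skew (L : forall p : M, tangent M p -> R) V W Y Z u :
  finsler L -> cartan_connection D L ->
  smooth_vf V -> smooth_vf W -> smooth_pi Y -> smooth_pi Z ->
  metric L (curvature D V W Y u) (Z u) = - metric L (Y u) (curvature D V W Z u).
Proof.
move=> hL hD sV sW sY sZ.
have gm := cartan_connection_metric hD.
have sg := smooth_metric hL.
have sc := smooth_covd lD.
have E V' : smooth_vf V' ->
    (fun w => dirder (fun w => metric L (Y w) (Z w) : R^o) (V' w)) =
    (fun w => metric L (covd D V' Y w) (Z w) + metric L (Y w) (covd D V' Z w)).
  by move=> _; apply/funext => w; exact: gm.
have E2 V1 V2 : smooth_vf V1 -> smooth_vf V2 ->
    dirder (fun w => dirder (fun w => metric L (Y w) (Z w) : R^o) (V2 w) : R^o) (V1 u) =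
    (metric L (covd D V1 (covd D V2 Y) u) (Z u) + metric L (covd D V2 Y u) (covd D V1 Z u))
    + (metric L (covd D V1 Y u) (covd D V2 Z u) + metric L (Y u)
      (covd D V1 (covd D V2 Z) u)).
  move=> s1 s2; rewrite (E V2 s2).
  apply: (etrans (dirder_add hS (V1 u) (sg _ _ (sc _ _ s2 sY) sZ)
    (sg _ _ sY (sc _ _ s2 sZ)))).
  exact: (f_equal2 (fun x y => x + y) (gm _ _ _ _ (sc _ _ s2 sY) sZ)
    (gm _ _ _ _ sY (sc _ _ s2 sZ))).
have B := dirder_lie_bracket hS sV sW u (sg _ _ sY sZ).
have B1 := etrans (esym (gm _ _ _ _ sY sZ))
  (etrans B (f_equal2 (fun x y => x - y) (E2 V W sV sW) (E2 W V sW sV))).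
have expl (a b c w : tangent M (base_pt u)) :
    metric L (- a + b + c) w = - metric L a w + metric L b w + metric L c w.
  by rewrite !metricDl metricNl.
have expr (a b c w : tangent M (base_pt u)) :
    metric L w (- a + b + c) = - metric L w a + metric L w b + metric L w c.
  by rewrite (metricC hL) expl !(metricC hL _ w).
apply: (etrans (expl _ _ _ _)); apply: (etrans _ (congr1 -%R (esym (expr _ _ _ _)))).
exact: (skew_arith B1).
Qed.

End Brackets.

(** * Symmetry of the (h)hv-torsion of the Cartan connection *)

Lemma torsion_arith {R : realFieldType} (p q r s t : R) :
  p + q = r + s + t -> p - r + (q - s) = t.
Proof. by move=> h; lra. Qed.

Lemma double_inj {R : realFieldType} (p q : R) : p + p = q + q -> p = q.
Proof. by move=> h; lra. Qed.

Section CartanTorsion.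
Context {R : realType} {n : nat} (M : manifold R n).
Variables (L : forall p : M, tangent M p -> R) (D : pi_derivation M).
Hypotheses (hL : finsler L) (hD : cartan_connection D L).
Local Notation slitM := (slit_atlas M).
Let lD := cartan_connection_linear hD.
Let rD := cartan_connection_regular hD.
Let hM := manifold_smooth_atlas M.
Let hS := slit_smooth_atlas M.
Let oI (a : chart M) : open (chart_image (A := slitM) a) := @chart_image_open _ _ _ _ hS a.
Implicit Types (u : slit M) (V W : vector_field slitM) (X Y Z : pi_section M).

(** The derivative D_x D_y D_w of L^2 along the fibre, in the chart a; the directions y and w
    are expanded in coordinates, as in the coordinate expression of the metric. *)
Definition fiber_third (a : chart M) (z : 'rV[R]_(n + n)) (x y w : 'rV[R]_n) : R :=
  \sum_i \sum_j y 0 i * w 0 j * 'D_(row_mx 0 x) (hessian_coef L a i j) z.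

(** Symmetry of second derivatives, applied to the first fibre derivatives of L^2. *)
Lemma fiber_third_sym a z x y w : chart_image (A := slitM) a z ->
  fiber_third a z x y w = fiber_third a z y x w.
Proof.
move=> az.
pose G j := 'D_(row_mx (0 : 'rV[R]_n) (delta_mx 0 j)) (energy_rep L a).
have sG j : smooth_on (chart_image (A := slitM) a) (G j).
  exact: (smooth_derive (@oI a) _ (@smooth_energy_rep _ _ _ _ hL a)).
have E s t : fiber_third a z s t w =
    \sum_j w 0 j * 'D_(row_mx (0 : 'rV[R]_n) s) ('D_(row_mx (0 : 'rV[R]_n) t) (G j)) z.
  rewrite /fiber_third exchange_big; apply: eq_bigr => j _.
  have dG v : differentiable ('D_v (G j)) z :=
    smooth_differentiable (@oI a) (smooth_derive (@oI a) v (sG j)) az.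
  have e1 := schwarz (row_mx 0 t) (row_mx 0 s) (@oI a) (sG j) az.
  have e2 := derive_sum_scale (index_enum _) (fun i => t 0 i)
    (fun i => row_mx (0 : 'rV[R]_n) (delta_mx 0 i)) (dG (row_mx 0 s)).
  have e3 := congr1 (fun v => 'D_v ('D_(row_mx 0 s) (G j)) z) (row_mx0_basis t).
  apply: (etrans _ (congr1 (fun r => w 0 j * r) (esym (etrans e1 (etrans e3 e2))))).
  rewrite mulr_sumr; apply: eq_bigr => i _.
  rewrite [t 0 i * w 0 j]mulrC -mulrA; do 2 apply: congr1.
  exact: (schwarz (row_mx 0 (delta_mx 0 i)) (row_mx 0 s) (@oI a) (sG j) az).
rewrite (E x y) (E y x); apply: eq_bigr => j _; apply: congr1.
exact: (schwarz (row_mx 0 y) (row_mx 0 x) (@oI a) (sG j) az).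
Qed.

(** The product rule for sum_ij g_ij Y^i Z^j. The derivatives of the components of Y and Z
    along a vertical vector are the base parts of brackets with the horizontal lifts. *)
Lemma metric_derivative_vertical (a : chart M) X Y Z u :
  smooth_pi X -> smooth_pi Y -> smooth_pi Z -> chart_dom a (base_pt u) ->
  dirder (fun w => metric L (Y w) (Z w) : R^o) (gamma (X u)) =
    metric L (rho (lie_bracket (gamma_vf X) (beta_vf D Y) u)) (Z u)
    + metric L (Y u) (rho (lie_bracket (gamma_vf X) (beta_vf D Z) u))
    + 2^-1 * fiber_third a (bundle_coord a (vec u)) (component a (X u))
        (component a (Y u)) (component a (Z u)).
Proof.
move=> sX sY sZ au; set z := bundle_coord a (vec u).
have az : chart_image (A := slitM) a z by exists u.
have sg := smooth_metric hL sY sZ.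
have dg := smooth_map_differentiable hS sg (au : chart_dom (a : chart slitM) u).
have e1 := dirder_chart hS (gamma (X u)) (au : chart_dom (a : chart slitM) u) dg.
have e2 := near_eq_derive (row_mx 0 (component a (X u)))
  (open_near_eq (@oI a) az (@metric_repE _ _ _ _ hL a Y Z)).
have e3 := @derive_form_sum _ _ _ _ (2^-1) (pi_rep a Y) (pi_rep a Z) (hessian_coef L a) z
  (row_mx 0 (component a (X u))) (@oI a) (@sY a) (@sZ a)
    (fun i j => @smooth_hessian_coef _ _ _ _ hL a i j) az.
have e0 := congr1 (fun v => 'D_v (local_rep (A := slitM) a
  (fun w => metric L (Y w) (Z w) : R^o)) z)
  (component_gamma (X u) au).
apply: (etrans e1); apply: (etrans e0); apply: (etrans e2); apply: (etrans e3).
have cY := component_rho_lie_gamma_beta lD rD sX sY au.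
have cZ := component_rho_lie_gamma_beta lD rD sX sZ au.
have rY : pi_rep a Y z = component a (Y u) := pi_repE Y au.
have rZ : pi_rep a Z z = component a (Z u) := pi_repE Z au.
have hess (v w : tangent M (base_pt u)) (v' w' : 'rV[R]_n) : component a v = v' ->
  component a w = w' ->
    metric L v w = 2^-1 * \sum_i \sum_j v' 0 i * w' 0 j * hessian_coef L a i j z.
  by move=> <- <-; rewrite (metric_hessian hL _ _ au) (fiber_hessian_coef hL _ _ az).
rewrite (hess _ _ _ _ cY (esym rZ)) (hess _ _ _ _ (esym rY) cZ) /fiber_third -rY -rZ.
rewrite -!mulrDr; apply: congr1; rewrite -!big_split; apply: eq_bigr => i _ /=.
by rewrite -!big_split; apply: eq_bigr => j _.
Qed.

(** Metricity and the preceding product rule give that g(T(X,Y),Z) + g(Y,T(X,Z)) is the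
    derivative of the metric coefficients along gamma X, and by the symmetry of T required
    of the Cartan connection both summands are equal. So g(T(X,Y),Z) is a fourth of a third
    derivative of L^2. *)
Lemma T_torsion_third (a : chart M) X Y Z u :
  smooth_pi X -> smooth_pi Y -> smooth_pi Z -> chart_dom a (base_pt u) ->
  metric L (T_torsion D X Y u) (Z u) + metric L (T_torsion D X Y u) (Z u) =
    2^-1 * fiber_third a (bundle_coord a (vec u)) (component a (X u))
        (component a (Y u)) (component a (Z u)).
Proof.
move=> sX sY sZ au.
have e1 := metric_derivative_vertical sX sY sZ au.
have e2 := cartan_connection_metric hD (gamma (X u)) sY sZ.
have e3 := cartan_connection_T hD sX sY sZ u.
have gen (tY tZ dY dZ bY bZ y z : tangent M (base_pt u)) (t : R) :
    tY = dY - bY -> tZ = dZ - bZ -> metric L tY z = metric L tZ y ->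
    metric L dY z + metric L y dZ = metric L bY z + metric L y bZ + t ->
    metric L tY z + metric L tY z = t.
  move=> hY hZ sym h; rewrite {2}sym (metricC hL tZ) hY hZ metricDl metricNl (metricDr hL).
  have Nr : metric L y (- bZ) = - metric L y bZ by rewrite (metricC hL) metricNl
    (metricC hL).
  by rewrite Nr; exact: torsion_arith h.
exact: (gen _ _ _ _ _ _ _ _ _ (T_torsionE lD rD X Y u) (T_torsionE lD rD X Z u) e3
  (etrans (esym e2) e1)).
Qed.

Lemma T_torsion_sym X Y Z u : smooth_pi X -> smooth_pi Y -> smooth_pi Z ->
  metric L (T_torsion D X Y u) (Z u) = metric L (T_torsion D Y X u) (Z u).
Proof.
move=> sX sY sZ; have cu : chart_dom (chart_at M (base_pt u)) (base_pt u) by exact: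
  chart_at_dom.
have e1 := T_torsion_third sX sY sZ cu; have e2 := T_torsion_third sY sX sZ cu.
rewrite fiber_third_sym in e1; last by exists u.
exact: double_inj (etrans e1 (esym e2)).
Qed.

End CartanTorsion.

(** * Concurrent sections *)

Section Concurrent.
Context {R : realType} {n : nat} (M : manifold R n).
Variables (D : pi_derivation M) (zeta : pi_section M).
Hypotheses (lD : linear_connection D) (rD : regular D) (hz : concurrent D zeta).
Local Notation slitM := (slit_atlas M).
Implicit Types (u : slit M) (V W : vector_field slitM) (X Y Z : pi_section M).
Let hS := slit_smooth_atlas M.
Let sz := concurrent_smooth hz.

(** The two conditions on zeta concern lifts of global sections; every smooth field is
    the sum of the lifts of the smooth sections rho V and vertical_part V. *)
Lemma concurrent_covd V : smooth_vf V -> covd D V zeta = fun u => - rho_vf V u.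
Proof.
move=> sV; apply: functional_extensionality_dep => u.
apply: (etrans (connection_decomp lD rD V u sz)).
have e1 := concurrent_beta hz (smooth_rho sV) u.
have e2 := concurrent_gamma hz (smooth_vertical_part lD rD sV) u.
by apply: (etrans (f_equal2 (fun x y => x + y) e1 e2)); rewrite addr0.
Qed.

(** Substituting the covariant derivatives of zeta turns the three terms of the curvature
    into the three terms of the torsion. *)
Lemma curvature_concurrent V W u : smooth_vf V -> smooth_vf W ->
  curvature D V W zeta u = torsion D V W u.
Proof.
move=> sV sW.
have c V' W' : smooth_vf V' -> smooth_vf W' ->
    covd D V' (covd D W' zeta) u = - covd D V' (rho_vf W') u.
  move=> s1 s2; apply: (etrans (congr1 (fun s => covd D V' s u) (concurrent_covd s2))).
  exact: (connection_opp lD _ (smooth_rho s2)).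
have l := congr1 (fun s => s u) (concurrent_covd (smooth_lie_bracket hS sV sW)).
have z (a a' b b' d d' : tangent M (base_pt u)) : a' = - a -> b' = - b -> d' = - d ->
   - a' + b' + d' = a - b - d by move=> -> -> ->; rewrite opprK.
exact: (z _ _ _ _ _ _ (c V W sV sW) (c W V sW sV) l).
Qed.

(** The Leibniz rule: the derivative of the curvature at zeta is the derivative of the
    torsion B, corrected by the curvature applied to nabla_V zeta = - rho V. *)
Lemma covd_tensor3_concurrent (E F : pi_section M -> vector_field slitM)
    (B : pi_section M -> pi_section M -> pi_section M) V X Y u :
  (forall X, smooth_pi X -> smooth_vf (E X)) ->
  (forall X, smooth_pi X -> smooth_vf (F X)) ->
  (forall X Y u, smooth_pi X -> smooth_pi Y -> torsion D (E X) (F Y) u = B X Y u) ->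
  smooth_vf V -> smooth_pi X -> smooth_pi Y ->
  covd_tensor3 D V (fun X Y Z => curvature D (E X) (F Y) Z) X Y zeta u =
    covd_tensor2 D V B X Y u + curvature D (E X) (F Y) (rho_vf V) u.
Proof.
move=> sE sF tB sV sX sY.
have K X' Y' : smooth_pi X' -> smooth_pi Y' -> curvature D (E X') (F Y') zeta = B X' Y'.
  move=> s1 s2; apply: functional_extensionality_dep => w.
  apply: (etrans (curvature_concurrent w (sE _ s1) (sF _ s2))); exact: tB.
have sc := smooth_covd lD sV.
have k1 := congr1 (fun s => covd D V s u) (K X Y sX sY).
have k2 := congr1 (fun s => s u) (K _ _ (sc X sX) sY).
have k3 := congr1 (fun s => s u) (K _ _ sX (sc Y sY)).
have k4 : curvature D (E X) (F Y) (covd D V zeta) u =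
  - curvature D (E X) (F Y) (rho_vf V) u.
  apply: (etrans (congr1 (fun s => curvature D (E X) (F Y) s u) (concurrent_covd sV))).
  exact: (curvature_opp lD u (sE _ sX) (sF _ sY) (smooth_rho sV)).
have z (a b c d a' b' c' d' : tangent M (base_pt u)) : a = a' -> b = b' -> c = c' ->
  d = - d' ->
  a - b - c - d = a' - b' - c' + d' by move=> -> -> -> ->; rewrite opprK.
exact: (z _ _ _ _ _ _ _ _ k1 k2 k3 k4).
Qed.

Lemma covd_tensor2_zero V X Y u : covd_tensor2 D V (fun _ _ _ => 0) X Y u = 0.
Proof. by rewrite /covd_tensor2 !subr0; exact: (connection0 lD). Qed.

Lemma covd_tensor2_opp_swap V (B : pi_section M -> pi_section M -> pi_section M) X Y u :
  smooth_pi (B Y X) ->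
  covd_tensor2 D V (fun X Y u => - B Y X u) X Y u = - covd_tensor2 D V B Y X u.
Proof.
move=> sB.
have z (a b c a' : tangent M (base_pt u)) : a' = - a -> a' - (- b) - (- c) = - (a - c - b).
  by move=> ->; rewrite !opprK !opprD !opprK addrAC.
exact: (z _ _ _ _ (connection_opp lD _ sB)).
Qed.

End Concurrent.

Theorem proposition2p4 (R : realType) (n : nat) (M : manifold R n)
    (L : forall p : M, tangent M p -> R) (hL : finsler L)
    (nabla : pi_derivation M) (hnabla : cartan_connection nabla L)
    (zeta : pi_section M) (hzeta : concurrent nabla zeta)
    (X Y Z : pi_section M)
    (hX : smooth_pi X) (hY : smooth_pi Y) (hZ : smooth_pi Z) :
  let g := @metric R n M L in
  let T := T_torsion nabla in
  let S := S_curv nabla in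
  let P := P_curv nabla in
  let Rh := R_curv nabla in
  let beta := beta_vf nabla in
  let gamma := @gamma_vf R n M in
  let nabla2 := covd_tensor2 nabla in
  let nabla3 := covd_tensor3 nabla in
  (forall u, S X Y zeta u = 0 /\ g u (S X Y Z u) (zeta u) = 0) /\
  (forall u, nabla3 (gamma Z) S X Y zeta u = 0 /\
             nabla3 (beta Z) S X Y zeta u = S X Y Z u) /\
  (forall u, nabla3 (beta zeta) S X Y zeta u = 0) /\
  (forall u, P X Y zeta u = - T Y X u /\
             g u (P X Y Z u) (zeta u) = g u (T X Y u) (Z u)) /\
  (forall u, nabla3 (gamma Z) P X Y zeta u = - nabla2 (gamma Z) T Y X u /\
             nabla3 (beta Z) P X Y zeta u =
               - nabla2 (beta Z) T Y X u + P X Y Z u) /\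
  (forall u, nabla3 (beta zeta) P X Y zeta u =
               - nabla2 (beta zeta) T Y X u - T Y X u) /\
  (forall u, Rh X Y zeta u = 0 /\ g u (Rh X Y Z u) (zeta u) = 0) /\
  (forall u, nabla3 (gamma Z) Rh X Y zeta u = 0 /\
             nabla3 (beta Z) Rh X Y zeta u = Rh X Y Z u) /\
  (forall u, nabla3 (beta zeta) Rh X Y zeta u = 0).
Proof.
move=> g T S P Rh beta gamma nabla2 nabla3.
have lD := cartan_connection_linear hnabla.
have rD := cartan_connection_regular hnabla.
have sz := concurrent_smooth hzeta.
have sg X' : smooth_pi X' -> smooth_vf (gamma X') by exact: smooth_gamma.
have sb X' : smooth_pi X' -> smooth_vf (beta X') by exact: smooth_beta.
have sT : smooth_pi (T Y X) by exact: smooth_T_torsion.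
have tS X' Y' u : smooth_pi X' -> smooth_pi Y' -> torsion nabla (gamma X') (gamma Y') u = 0.
  exact: torsion_gamma_gamma.
have tR X' Y' u : smooth_pi X' -> smooth_pi Y' -> torsion nabla (beta X') (beta Y') u = 0.
  by move=> s1 s2; exact: (cartan_connection_Q hnabla s1 s2).
have tP X' Y' u : smooth_pi X' -> smooth_pi Y' ->
  torsion nabla (beta X') (gamma Y') u = - T Y' X' u.
  by move=> _ _; exact: torsion_antisym.
have aS u : S X Y zeta u = 0.
  by apply: (etrans (curvature_concurrent lD rD hzeta u (sg _ hX) (sg _ hY))); exact: tS.
have aR u : Rh X Y zeta u = 0.
  by apply: (etrans (curvature_concurrent lD rD hzeta u (sb _ hX) (sb _ hY))); exact: tR.
have aP u : P X Y zeta u = - T Y X u.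
  by apply: (etrans (curvature_concurrent lD rD hzeta u (sb _ hX) (sg _ hY))); exact: tP.
have skew V W u : smooth_vf V -> smooth_vf W ->
    g u (curvature nabla V W Z u) (zeta u) = - g u (curvature nabla V W zeta u) (Z u).
  move=> sV sW; have e := curvature_metric_skew lD u hL hnabla sV sW hZ sz.
  by apply: (etrans e); apply: congr1; exact: (metricC hL).
have skew0 V W u : smooth_vf V -> smooth_vf W -> curvature nabla V W zeta u = 0 ->
    g u (curvature nabla V W Z u) (zeta u) = 0.
  move=> sV sW c0; apply: (etrans (skew V W u sV sW)); rewrite c0.
  by rewrite /g metric0l oppr0.
have c0 V W := curvature0 lD V W.
have nS := covd_tensor3_concurrent lD rD hzeta _ sg sg tS _ hX hY.
have nR := covd_tensor3_concurrent lD rD hzeta _ sb sb tR _ hX hY.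
have nP := covd_tensor3_concurrent lD rD hzeta _ sb sg tP _ hX hY.
have rg : rho_vf (gamma Z) = fun u => 0 := rho_vf_gamma Z.
have rb X' : rho_vf (beta X') = X' := rho_vf_beta rD X'.
have z2 V := covd_tensor2_zero lD V X Y.
have s2 V u := covd_tensor2_opp_swap lD V u sT.
split; last split; last split; last split; last split; last split; last split; last split.
- by move=> u; split; [exact: aS|apply: (skew0 _ _ _ (sg _ hX) (sg _ hY)); exact: aS].
- move=> u; split.
    apply: (etrans (nS _ u (sg _ hZ))); rewrite z2 add0r rg; exact: c0.
  by apply: (etrans (nS _ u (sb _ hZ))); rewrite z2 add0r rb.
- move=> u; apply: (etrans (nS _ u (sb _ sz))); rewrite z2 add0r rb; exact: aS.
- move=> u; split; first exact: aP.
  apply: (etrans (skew _ _ u (sb _ hX) (sg _ hY))).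
  apply: (etrans (congr1 (fun v => - g u v (Z u)) (aP u))).
  rewrite /g metricNl opprK; exact: (T_torsion_sym hL hnabla).
- move=> u; split.
    apply: (etrans (nP _ u (sg _ hZ))); rewrite s2 rg.
    by apply: (etrans (congr1 (fun v => _ + v) (c0 _ _ u))); rewrite addr0.
  by apply: (etrans (nP _ u (sb _ hZ))); rewrite s2 rb.
- move=> u; apply: (etrans (nP _ u (sb _ sz))); rewrite s2 rb.
  exact: (congr1 (fun v => _ + v) (aP u)).
- by move=> u; split; [exact: aR|apply: (skew0 _ _ _ (sb _ hX) (sb _ hY)); exact: aR].
- move=> u; split.
    apply: (etrans (nR _ u (sg _ hZ))); rewrite z2 add0r rg; exact: c0.
  by apply: (etrans (nR _ u (sb _ hZ))); rewrite z2 add0r rb.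
- move=> u; apply: (etrans (nR _ u (sb _ sz))); rewrite z2 add0r rb; exact: aR.
Qed.
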